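(* Let $X$ be a symmetrically self-similar graph with bounded geometry, origin vertex $\mathbf{o}$ and branching number $\theta=2$. If, additionally, $X$ is bipartite and its Green's function $G(z)=\sum_np^{(n)}(\mathbf{o},\mathbf{o})z^n$ is algebraic, then the closed cell $\hat C$ is a finite path graph.
   Context: Graphs are simple and undirected. For a subgraph $C$ of $X$, $\theta C$ is the set of vertices outside $C$ adjacent to $C$, and $\hat C$ is the induced subgraph on $V(C)\cup\theta C$. A connected infinite graph $X$ is self-similar w.r.t. a vertex set $B$ and $\psi:V(X)\to V(X_B)$ (where $X_B$ is the graph on $B$ with an edge $\{x,y\}$ whenever some component of $X\setminus B$ has both $x,y$ in its boundary) if no two vertices of $B$ are adjacent, boundaries of distinct components of $X\setminus B$ meet in at most one vertex, and $\psi$ is a graph isomorphism $X\to X_B$; components of $X\setminus B$ are cells. It is symmetrically self-similar if moreover it is locally finite, cells are finite, any two closed cells are isomorphic via a boundary-preserving map, and $\mathrm{Aut}(\hat C)$ acts doubly transitively on $\theta C$. The origin vertex is a fixed point of $\psi$; the branching number is $\theta=|\theta C|$; bounded geometry means uniformly bounded degrees. $p^{(n)}(x,y)$ is the $n$-step transition probability of the simple random walk (moving to each neighbour with probability $1/\deg$). *)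

(* Defs.v *)
From HB Require Import structures.
From mathcomp Require Import all_boot all_order all_algebra.
From mathcomp Require Import polyXY complex.
From mathcomp Require Import finmap.
From mathcomp Require Import all_classical all_reals all_analysis.

Set Implicit Arguments.
Unset Strict Implicit.
Unset Printing Implicit Defensive.

Import Order.TTheory GRing.Theory Num.Theory.
Import numFieldNormedType.Exports.

Local Open Scope classical_set_scope.
Local Open Scope ring_scope.
Local Open Scope complex_scope.

(* The vertices form a subset of an ambient type, so that X, X_B, X \ B and
   the closed cells are all graphs over the same type. *)
Record graph (T : choiceType) := Graph {
  vset : set T;
  edge : rel T;
  edge_sym : symmetric edge;
  edge_irr : irreflexive edge;
  edge_vset : forall x y, edge x y -> vset x }.

Section Graphs.
Variable T : choiceType.
Implicit Types (G X : graph T) (A B C D : set T).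

Definition joined G (x y : T) : Prop :=
  exists2 p : seq T, path (edge G) x p & last x p = y.

Definition graph_connected G : Prop :=
  vset G !=set0 /\ forall x y, vset G x -> vset G y -> joined G x y.

Definition nbrs G (x : T) : set T := [set y | edge G x y].

(* Only meaningful when [nbrs G x] is finite. *)
Definition degree G (x : T) : nat := #|` fset_set (nbrs G x)|%fset.

Definition locally_finite G : Prop :=
  forall x, vset G x -> finite_set (nbrs G x).

Definition bounded_geometry G : Prop :=
  exists M : nat, forall x, vset G x ->
    finite_set (nbrs G x) /\ (degree G x <= M)%N.

Definition bipartite G : Prop :=
  exists color : T -> bool, forall x y, edge G x y -> color x != color y.

Definition induced_edge G A : rel T :=
  fun x y => [&& x \in A, y \in A & edge G x y].

Lemma induced_edge_sym G A : symmetric (induced_edge G A).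
Proof. by move=> x y; rewrite /induced_edge edge_sym andbCA. Qed.

Lemma induced_edge_irr G A : irreflexive (induced_edge G A).
Proof. by move=> x; rewrite /induced_edge edge_irr !andbF. Qed.

Lemma induced_edge_vset G A x y :
  induced_edge G A x y -> (vset G `&` A) x.
Proof. by case/and3P=> /set_mem Ax _ /edge_vset. Qed.

Definition induced G A : graph T :=
  Graph (@induced_edge_sym G A) (@induced_edge_irr G A)
        (@induced_edge_vset G A).

Definition component G C : Prop :=
  exists2 x, vset G x & C = [set y | joined G x y].

Definition boundary G C : set T :=
  [set y | vset G y /\ ~ C y /\ exists2 x, C x & edge G x y].

Definition closed_cell G C : graph T := induced G (C `|` boundary G C).

Definition cell X B C : Prop := component (induced X (~` B)) C.

Definition quot_edge X B : rel T :=
  fun x y => [&& x != y, x \in B, y \in B &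
    `[< exists C, [/\ cell X B C, boundary X C x & boundary X C y] >]].

Lemma quot_edge_sym X B : symmetric (quot_edge X B).
Proof.
move=> x y; rewrite /quot_edge eq_sym; congr (_ && _); rewrite andbCA.
congr [&& _, _ & _]; apply/asboolP/asboolP => -[C [? ? ?]]; by exists C; split.
Qed.

Lemma quot_edge_irr X B : irreflexive (quot_edge X B).
Proof. by move=> x; rewrite /quot_edge eqxx. Qed.

Lemma quot_edge_vset X B x y : quot_edge X B x y -> B x.
Proof. by case/and4P=> _ /set_mem. Qed.

(* The graph X_B. *)
Definition quot_graph X B : graph T :=
  Graph (@quot_edge_sym X B) (@quot_edge_irr X B) (@quot_edge_vset X B).

End Graphs.

Definition graph_iso (T U : choiceType) (G : graph T) (H : graph U)
    (f : T -> U) : Prop :=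
  set_bij (vset G) (vset H) f /\
  forall x y, vset G x -> vset G y -> edge H (f x) (f y) = edge G x y.

Section SelfSimilar.
Variable T : choiceType.
Implicit Types (X : graph T) (B C D : set T) (psi : T -> T).

Definition self_similar X B psi : Prop :=
  [/\ graph_connected X /\ infinite_set (vset X),
      B `<=` vset X,
      forall x y, B x -> B y -> ~~ edge X x y,
      forall C D, cell X B C -> cell X B D -> C <> D ->
        forall x y, (boundary X C `&` boundary X D) x ->
                    (boundary X C `&` boundary X D) y -> x = y
    & graph_iso X (quot_graph X B) psi].

Definition doubly_transitive_boundary X C : Prop :=
  forall a b c d, boundary X C a -> boundary X C b ->
    boundary X C c -> boundary X C d -> a <> b -> c <> d ->
  exists g : T -> T,
    [/\ graph_iso (closed_cell X C) (closed_cell X C) g,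
        g @` boundary X C = boundary X C, g a = c & g b = d].

Definition symmetrically_self_similar X B psi : Prop :=
  [/\ self_similar X B psi,
      locally_finite X,
      forall C, cell X B C -> finite_set C,
      forall C D, cell X B C -> cell X B D ->
        exists f : T -> T, graph_iso (closed_cell X C) (closed_cell X D) f /\
          f @` boundary X C = boundary X D
    & forall C, cell X B C -> doubly_transitive_boundary X C].

Definition origin_vertex X psi (o : T) : Prop := vset X o /\ psi o = o.

Definition branching_number X B (theta : nat) : Prop :=
  forall C, cell X B C -> (boundary X C #= `I_theta)%card.

End SelfSimilar.

Section Path.
Variable n : nat.

Definition path_edge : rel nat :=
  fun i j => [&& i < n, j < n & (i.+1 == j) || (j.+1 == i)]%N.

Lemma path_edge_sym : symmetric path_edge.
Proof. by move=> i j; rewrite /path_edge orbC andbCA. Qed.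

Lemma path_edge_irr : irreflexive path_edge.
Proof. by move=> i; rewrite /path_edge orbb eqn_leq ltnn !andbF. Qed.

Lemma path_edge_vset i j : path_edge i j -> `I_n i.
Proof. by case/and3P. Qed.

Definition path_graph : graph nat :=
  Graph path_edge_sym path_edge_irr path_edge_vset.

End Path.

(* The sum for the metric topology given by the norm of [K]; only meaningful
   where the series converges.  Stated over a generic [K] because [R[i]] gets
   its topology only as a [numFieldType]. *)
Definition power_series_sum (K : numFieldType) (a : nat -> K) (z : K) : K :=
  limn [series a n * z ^+ n]_n.

Section RandomWalk.
Variables (R : realType) (T : choiceType) (X : graph T).

Fixpoint srw_prob (n : nat) (x y : T) : R :=
  if n is m.+1 then
    \sum_(w \in nbrs X x) (degree X x)%:R^-1 * srw_prob m w y
  else (x == y)%:R.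

Definition green (o : T) (z : R[i]) : R[i] :=
  power_series_sum (fun n => (srw_prob n o o)%:C) z.

End RandomWalk.

(* [P] is a polynomial in the function value with coefficients polynomial in
   [z]; [P.[f z, z]] evaluates it at [(f z, z)]. *)
Definition algebraic_on (R : realType) (D : set R[i]) (f : R[i] -> R[i]) : Prop :=
  exists2 P : {poly {poly R[i]}}, P != 0 &
    forall z, D z -> P.[f z, z] = 0.

Definition unit_disc (R : realType) : set R[i] := [set z | `|z| < 1].

(* Main.v *)
Require Import Defs.
From mathcomp Require Import all_boot all_order all_algebra.
From mathcomp Require Import polyXY complex finmap.
From mathcomp Require Import all_classical all_reals all_analysis.
From mathcomp Require Import ring lra zify.

(** Each boundary vertex [a], [b] of a cell has exactly one neighbour in the cell,
    because [psi] preserves the degree of the origin.  Let M(z) = Deg - z Adj on the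
    closed cell without [b], let c' be the neighbour of [b], and put f = (M^-1)_aa and
    d = z (M^-1)_c'a.  Comparing the resolvent at z on [X] with the resolvent at d(z)
    on [X_B], one gets G = f * (G o d) on (0,1), and by bipartiteness on (-1,1).

    If G is algebraic of degree n over C(z), uniqueness of its minimal polynomial
    yields an even rational function A = P/Q with A = f^n * (A o d).  Since d is real,
    of degree at least 2, and f has only real zeros and poles, the non-real poles of A
    would be stable under preimages by d with multiplicities, so there are none.  A
    pole in (0,1) would have an infinite decreasing forward orbit under d, and a pole
    in (1,oo) an infinite decreasing sequence of preimages in (1,z0), where z0 is the
    first singular point of M.  Hence Q is a multiple of (z - 1)^k (z + 1)^k.

    Orders at z0 give n <= 2k.  At z = 1 one has f(1) = r, the effective resistance
    between [a] and [b], and d'(1) = mu r with mu the number of edges of the closed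
    cell; thus (mu r)^k = r^n and r >= mu.  By Thomson's principle r is at most the
    length of any path from [a] to [b], so the closed cell is such a path. *)

(** * Symmetric pencils Deg - z Adj *)

(** A is the constant coefficient of the minimal polynomial of G divided by the leading one, hence
    up to sign the product of the n conjugates of G. This is the origin of the exponent n, and the
    reason why an equation for an algebraic function becomes one for a rational function.
    Composition with d is handled through polynomials homogenized in the numerator and denominator
    of d, because these may have common zeros and d is infinite at z0. The degree of d is at least 2
    since a and b are not adjacent: d vanishes to second order at 0. Evenness of A reflects negative
    poles to positive ones, and it gives the poles at 1 and -1 the same order k, whence the bound 2k
    rather than k. With r >= 1 this bound turns (mu r)^k = r^n <= r^(2k) into mu <= r. In the other
    direction r is at most the length of a simple path, which is at most mu; equality leaves no edge
    outside the path. *)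

Section Pencil.
Import Order.TTheory GRing.Theory Num.Theory.
Local Open Scope ring_scope.
Set Implicit Arguments.
Unset Strict Implicit.
Unset Printing Implicit Defensive.

Variables (R : realType) (N : nat) (D : 'I_N -> R) (A : 'I_N -> 'I_N -> R).
Implicit Types (z : R) (u v : 'I_N -> R).

Definition pencil z u i := D i * u i - z * \sum_j A i j * u j.
Definition pform z u v := \sum_i u i * pencil z v i.
Definition psd z := forall u, 0 <= pform z u u.
Definition pencil_mx : 'M[{poly R}]_N :=
  \matrix_(i, j) ((D i)%:P *+ (i == j) - 'X * (A i j)%:P).

Hypothesis D_gt0 : forall i, 0 < D i.
Hypothesis A_ge0 : forall i j, 0 <= A i j.
Hypothesis A_sym : forall i j, A i j = A j i.

Lemma pform_exp z u v :
  pform z u v = \sum_i D i * (u i * v i) - z * \sum_i \sum_j A i j * (u i * v j).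
Proof.
rewrite /pform /pencil mulr_sumr -sumrB; apply: eq_bigr => i _.
rewrite mulrBr mulrCA; congr (_ - _); rewrite mulrCA; congr (_ * _).
by rewrite mulr_sumr; apply: eq_bigr => j _; rewrite mulrCA.
Qed.

Lemma pformC z u v : pform z u v = pform z v u.
Proof.
rewrite !pform_exp; congr (_ - _ * _).
  by apply: eq_bigr => i _; rewrite [u i * _]mulrC.
rewrite exchange_big; apply: eq_bigr => i _; apply: eq_bigr => j _.
by rewrite A_sym [u j * _]mulrC.
Qed.

Lemma pencilD z u v t i :
  pencil z (fun j => u j + t * v j) i = pencil z u i + t * pencil z v i.
Proof.
rewrite /pencil; under eq_bigr do rewrite mulrDr mulrCA.
rewrite big_split /= -mulr_sumr; ring.
Qed.

Lemma pformD z u v t : pform z (fun j => u j + t * v j) (fun j => u j + t * v j)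
   = pform z u u + t * pform z u v *+ 2 + t ^+ 2 * pform z v v.
Proof.
have E : pform z (fun j => u j + t * v j) (fun j => u j + t * v j) =
  pform z u u + t * pform z u v + t * pform z v u + t ^+ 2 * pform z v v.
  rewrite /pform !mulr_sumr -!big_split /=; apply: eq_bigr => i _.
  rewrite pencilD; ring.
rewrite E (pformC z v u); ring.
Qed.

Lemma pform_CS z u v : psd z ->
  pform z u v ^+ 2 <= pform z u u * pform z v v.
Proof.
move=> Pz; set a := pform z u u; set b := pform z u v; set c := pform z v v.
have H t : 0 <= a + t * b *+ 2 + t ^+ 2 * c by rewrite -pformD; apply: Pz.
have a0 : 0 <= a by apply: Pz.
have c0 : 0 <= c by apply: Pz.
have [c00|cn0] := eqVneq c 0.
  have Hb t : 0 <= a + t * b *+ 2 by have := H t; rewrite c00 mulr0 addr0.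
  have [->|bn0] := eqVneq b 0; first by rewrite expr0n /= mulr_ge0.
  have := Hb (- (a + 1) / b); rewrite divfK //; lra.
have cp : 0 < c by rewrite lt_def cn0.
have := H (- b / c); have -> : a + - b / c * b *+ 2 + (- b / c) ^+ 2 * c = (a * c - b ^+ 2) / c by field.
by rewrite pmulr_lge0 ?invr_gt0 // subr_ge0.
Qed.

Lemma psd_ker z u : psd z -> pform z u u = 0 -> forall i, pencil z u i = 0.
Proof.
move=> Pz u0 i; have := pform_CS (fun j => (j == i)%:R) u Pz.
rewrite u0 mulr0 => H; have {H} : pform z (fun j => (j == i)%:R) u ^+ 2 == 0.
  by rewrite eq_le H sqr_ge0.
rewrite sqrf_eq0 /pform (bigD1 i) //= eqxx mul1r big1 ?addr0; first by move/eqP.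
by move=> j /negPf ->; rewrite mul0r.
Qed.

Lemma pform_abs z u : 0 <= z ->
  pform z (fun i => `|u i|) (fun i => `|u i|) <= pform z u u.
Proof.
move=> z0; rewrite !pform_exp lerB //.
  by apply: ler_sum => i _; rewrite -normrM [X in _ * X <= _]ger0_norm // -expr2 sqr_ge0.
apply: ler_wpM2l => //; apply: ler_sum => i _; apply: ler_sum => j _.
by rewrite ler_wpM2l // -normrM ler_norm.
Qed.

(** For 0 <= z' < z the form at z' is a convex combination, with weights 1 - z'/z and z'/z, of the
    forms at 0 and at z. *)
Lemma psd_pos z z' : 0 <= z' -> z' < z -> psd z ->
  forall u, (1 - z' / z) * \sum_i D i * u i ^+ 2 <= pform z' u u.
Proof.
move=> z'0 z'z Pz u; have zp : 0 < z by apply: le_lt_trans z'z.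
have := Pz u; rewrite !pform_exp.
have -> : \sum_i D i * (u i * u i) = \sum_i D i * u i ^+ 2 by apply: eq_bigr.
set d := \sum_i D i * _; set s := \sum_i \sum_j _ => H.
have -> : d - z' * s = (1 - z' / z) * d + z' / z * (d - z * s) by field; rewrite gt_eqF.
by rewrite lerDl mulr_ge0 // divr_ge0 // ltW.
Qed.

Lemma sumD_eq0 u : \sum_i D i * u i ^+ 2 <= 0 -> forall i, u i = 0.
Proof.
move=> H i; have H0 : \sum_i D i * u i ^+ 2 == 0.
  by rewrite eq_le H sumr_ge0 // => j _; rewrite mulr_ge0 ?sqr_ge0 // ltW.
move: H0; rewrite psumr_eq0; last by move=> j _; rewrite mulr_ge0 ?sqr_ge0 // ltW.
move/allP/(_ i); rewrite mem_index_enum => /(_ isT) /=.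
by rewrite mulf_eq0 gt_eqF //= sqrf_eq0 => /eqP.
Qed.

Lemma psd_lt_inj z z' : 0 <= z' -> z' < z -> psd z ->
  forall u, pform z' u u <= 0 -> forall i, u i = 0.
Proof.
move=> z'0 z'z Pz u H; apply: sumD_eq0.
have zp : 0 < z by apply: le_lt_trans z'z.
have := psd_pos z'0 z'z Pz u => /le_trans /(_ H).
by rewrite pmulr_rle0 // subr_gt0 ltr_pdivrMr // mul1r.
Qed.

(* Maximum principle: the negative part of [v] has nonpositive energy. *)
Lemma pencil_ge0 z z' v : 0 <= z' -> z' < z -> psd z ->
  (forall i, 0 <= pencil z' v i) -> forall i, 0 <= v i.
Proof.
move=> z'0 z'z Pz H; pose w i := Num.max (- v i) 0.
have w0 i : 0 <= w i by rewrite /w le_max lexx orbT.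
have wv i j : A i j * (w i * (v j + w j)) >= 0.
  rewrite !mulr_ge0 // /w; case: (leP (- v j) 0) => h; lra.
have wE i : w i * v i = - w i * w i.
  rewrite /w; case: (leP (- v i) 0) => h; ring.
have F : pform z' w w <= - pform z' w v.
  rewrite !pform_exp.
  have -> : \sum_i D i * (w i * v i) = - \sum_i D i * (w i * w i).
    by rewrite -sumrN; apply: eq_bigr => i _; rewrite wE mulNr mulrN.
  set d := \sum_i D i * _; set s1 := \sum_i \sum_j _ ; set s2 := \sum_i \sum_j _.
  have : 0 <= z' * (s1 + s2).
    rewrite mulr_ge0 // -big_split sumr_ge0 //= => i _.
    rewrite -big_split sumr_ge0 //= => j _.
    by have := wv i j; rewrite -mulrDr -mulrDr [v j + _]addrC.
  by rewrite mulrDr; lra.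
have G : 0 <= pform z' w v by apply: sumr_ge0 => i _; rewrite mulr_ge0.
have W i : w i = 0 by apply: (psd_lt_inj z'0 z'z Pz (u := w)); lra.
by move=> i; have := W i; rewrite /w; case: (leP (- v i) 0) => h; lra.
Qed.

Lemma pencil_gt0 z z' v : 0 <= z' -> z' < z -> psd z ->
  (forall i, 0 < pencil z' v i) -> forall i, 0 < v i.
Proof.
move=> z'0 z'z Pz H i.
have v0 := pencil_ge0 z'0 z'z Pz (fun i => ltW (H i)).
have := H i; rewrite /pencil => Hi.
have : 0 < D i * v i.
  apply: lt_le_trans Hi _; rewrite gerBl mulr_ge0 // sumr_ge0 // => j _.
  by rewrite mulr_ge0.
by rewrite pmulr_rgt0.
Qed.

Hypothesis conn : forall (S : pred 'I_N) i, S i ->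
  (forall j k, S j -> A j k != 0 -> S k) -> forall k, S k.

(* Perron-Frobenius: |u| is again a null vector, and it is superharmonic. *)
Lemma psd_ker_neq0 z u : 0 < z -> psd z -> pform z u u = 0 ->
  (exists i, u i != 0) -> forall i, u i != 0.
Proof.
move=> z0 Pz uu [i0 ui0] i; apply/negP => /eqP ui.
have := psd_ker Pz (u := fun i => `|u i|) _.
have -> : pform z (fun i => `|u i|) (fun i => `|u i|) = 0.
  by apply/eqP; rewrite eq_le Pz andbT -uu pform_abs // ltW.
move/(_ erefl) => K.
have := @conn (fun i => u i == 0) i; rewrite ui eqxx => /(_ isT) C.
suff : u i0 == 0 by apply/negP.
apply: C => j k /eqP uj Ajk; have /eqP := K j.
rewrite /pencil uj normr0 mulr0 sub0r oppr_eq0 mulf_eq0 gt_eqF //=.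
rewrite psumr_eq0; last by move=> l _; rewrite mulr_ge0.
move/allP/(_ k); rewrite mem_index_enum => /(_ isT) /=.
by rewrite mulf_eq0 (negPf Ajk) /= normr_eq0.
Qed.

Lemma pencil_mx_eval z i j :
  (map_mx (horner_eval z) pencil_mx) i j = D i *+ (i == j) - z * A i j.
Proof.
by rewrite /pencil_mx !mxE /horner_eval hornerD hornerN hornerMn hornerM !hornerE.
Qed.

Lemma pencil_mulmx z (w : 'cV[R]_N) i :
  (map_mx (horner_eval z) pencil_mx *m w) i 0 = pencil z (fun j => w j 0) i.
Proof.
rewrite mxE /pencil (eq_bigr (fun j => D i *+ (i == j) * w j 0 - z * (A i j * w j 0))).
  rewrite sumrB -mulr_sumr; congr (_ - _); rewrite (bigD1 i) //= eqxx big1 ?addr0 //.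
  by move=> j; rewrite eq_sym => /negPf ->; rewrite mul0r.
by move=> j _; rewrite pencil_mx_eval mulrBl mulrA.
Qed.

Lemma pencil_mx_sym : pencil_mx^T = pencil_mx.
Proof.
apply/matrixP => i j; rewrite !mxE A_sym eq_sym.
by case: eqP => [->|].
Qed.

Lemma det_pencil z : (\det pencil_mx).[z] = \det (map_mx (horner_eval z) pencil_mx).
Proof. by rewrite det_map_mx. Qed.

Lemma adj_pencil z i j :
  (\adj pencil_mx i j).[z] = (\adj (map_mx (horner_eval z) pencil_mx)) i j.
Proof. by rewrite -map_mx_adj [RHS]mxE. Qed.

Lemma pencil_ker z : (\det pencil_mx).[z] = 0 ->
  exists2 u, (exists i, u i != 0) & forall i, pencil z u i = 0.
Proof.
rewrite det_pencil => /eqP; rewrite -det_tr.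
case/det0P => v v0 Hv; exists (fun i => v 0 i).
  by have /rV0Pn[i Hi] := v0; exists i.
move=> i; have := congr1 (fun M : 'rV_N => M^T i 0) Hv.
rewrite trmx_mul trmxK pencil_mulmx => E.
move: E; rewrite [X in _ = X]mxE [X in _ = X]mxE => <-.
rewrite /pencil mxE; congr (_ - _ * _); apply: eq_bigr => j _; by rewrite mxE.
Qed.

Lemma det_pencil_neq0 z z' : 0 <= z' -> z' < z -> psd z ->
  (\det pencil_mx).[z'] != 0.
Proof.
move=> z'0 z'z Pz; apply/negP => /eqP /pencil_ker[u [i ui] K].
have : u i = 0.
  apply: (psd_lt_inj z'0 z'z Pz); rewrite /pform big1 // => j _.
  by rewrite K mulr0.
by move/eqP; apply/negP.
Qed.

Lemma sum_cross u i j : `|u i * u j| <= \sum_k u k ^+ 2.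
Proof.
have h k : u k ^+ 2 <= \sum_k u k ^+ 2.
  by rewrite (bigD1 k) //= lerDl sumr_ge0 // => l _; rewrite sqr_ge0.
have hi := h i; have hj := h j; rewrite normrM.
have := sqr_ge0 (`|u i| - `|u j|); rewrite sqrrB !real_normK ?num_real //.
by lra.
Qed.

(** An invertible semidefinite form is coercive: Cauchy-Schwarz for u and w = M^-1 u gives |u|^4 <=
    pform(u,u) pform(w,w), and the last factor is at most K0 |u|^2. So z can be raised a little. *)
Lemma psd_extend z : psd z -> (\det pencil_mx).[z] != 0 ->
  exists2 z', z < z' & psd z'.
Proof.
move=> Pz dz; pose M := map_mx (horner_eval z) pencil_mx.
have Mu : M \in unitmx by rewrite unitmxE unitfE -det_pencil.
pose K0 := \sum_i \sum_j `|invmx M i j| + 1.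
pose K1 := \sum_i \sum_j A i j + 1.
have K0p : 0 < K0 by rewrite ltr_wpDl // sumr_ge0 // => i _; rewrite sumr_ge0.
have K1p : 0 < K1 by rewrite ltr_wpDl // sumr_ge0 // => i _; rewrite sumr_ge0.
have sq0 u : 0 <= \sum_i u i ^+ 2 by rewrite sumr_ge0 // => i _; rewrite sqr_ge0.
have E u : \sum_i u i ^+ 2 <= K0 * pform z u u.
  pose w i := \sum_j invmx M i j * u j.
  have Mw i : pencil z w i = u i.
    have := pencil_mulmx z (invmx M *m \col_j u j) i.
    rewrite mulKVmx // mxE => ->.
    rewrite /pencil /w mxE; under [X in _ - _ * X = _]eq_bigr do under eq_bigr do idtac.
    congr (_ * _ - _ * _); first by apply: eq_bigr => j _; rewrite mxE.
    by apply: eq_bigr => j _; rewrite mxE; congr (_ * _); apply: eq_bigr => k _; rewrite mxE.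
  have S : pform z u w = \sum_i u i ^+ 2 by apply: eq_bigr => i _; rewrite Mw.
  have T : pform z w w <= K0 * \sum_i u i ^+ 2.
    rewrite /pform (eq_bigr (fun i => \sum_j invmx M i j * (u j * u i))); last first.
      by move=> i _; rewrite Mw /w mulr_suml; apply: eq_bigr => j _; rewrite mulrA.
    rewrite /K0 mulrDl mul1r; apply: ler_wpDr => //.
    rewrite mulr_suml; apply: ler_sum => i _; rewrite mulr_suml; apply: ler_sum => j _.
    apply: le_trans (ler_norm _) _; rewrite normrM ler_wpM2l //; exact: sum_cross.
  have := pform_CS u w Pz; rewrite S => CS.
  have [->|n0] := eqVneq (\sum_i u i ^+ 2) 0; first by rewrite mulr_ge0 ?(ltW K0p) //; exact: Pz.
  have p0 : 0 < \sum_i u i ^+ 2 by rewrite lt_def n0 sq0.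
  rewrite -(ler_pM2r p0) -expr2; apply: le_trans CS _.
  by rewrite [K0 * _]mulrC -mulrA ler_wpM2l // Pz.
(* The adjacency form is at most K1 |u|^2, hence at most K0 K1 times the form at z, so this increase
   costs at most the form itself. *)
exists (z + (K0 * K1)^-1) => [|u]; first by rewrite ltrDl invr_gt0 mulr_gt0.
have F : \sum_i \sum_j A i j * (u i * u j) <= K1 * \sum_i u i ^+ 2.
  rewrite /K1 mulrDl mul1r; apply: ler_wpDr => //.
  rewrite mulr_suml; apply: ler_sum => i _; rewrite mulr_suml; apply: ler_sum => j _.
  rewrite ler_wpM2l //; apply: le_trans (ler_norm _) _; exact: sum_cross.
have := E u; rewrite !pform_exp (mulrDl z) opprD addrA.
set X := _ - z * _; set s := \sum_i \sum_j _ in F * => EX.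
rewrite subr_ge0 mulrC ler_pdivrMr ?mulr_gt0 //.
apply: le_trans F _; apply: le_trans (_ : K1 * (K0 * X) <= _); first by rewrite ler_wpM2l // ltW.
by rewrite le_eqVlt; apply/orP; left; apply/eqP; ring.
Qed.

(** z0 is the supremum of the parameters with a semidefinite form; the vector u makes that set
    bounded, the condition is closed, and by [psd_extend] an invertible pencil would not be
    extremal. *)
Lemma psd_sup : psd 1 -> (\det pencil_mx).[1] != 0 ->
  (exists u, 0 < \sum_i \sum_j A i j * (u i * u j)) ->
  exists z0, [/\ 1 < z0, psd z0 & (\det pencil_mx).[z0] = 0].
Proof.
move=> P1 d1 [u Hu]; pose S := [set z | psd z]%classic.
have ubS v : 0 < \sum_i \sum_j A i j * (v i * v j) ->
  ubound S ((\sum_i D i * (v i * v i)) / \sum_i \sum_j A i j * (v i * v j)).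
  by move=> Hv z /(_ v); rewrite pform_exp subr_ge0 ler_pdivlMr.
have hS : has_sup S by split; [exists 1 | eexists; exact: ubS Hu].
have P0 : psd (sup S).
  move=> v; rewrite leNgt; apply/negP => H.
  have S1 : 1 <= sup S by apply: ub_le_sup => //; case: hS.
  have s0 : 0 < \sum_i \sum_j A i j * (v i * v j).
    rewrite ltNge; apply/negP => h; move: H; rewrite pform_exp ltNge; apply/negP; rewrite negbK.
    rewrite subr_ge0; apply: le_trans (_ : 0 <= _).
      by apply: mulr_ge0_le0 => //; apply: le_trans S1.
    by apply: sumr_ge0 => i _; rewrite mulr_ge0 ?(ltW (D_gt0 _)) // -expr2 sqr_ge0.
  have : sup S <= _ := ge_sup (proj1 hS) (ubS v s0).
  rewrite ler_pdivlMr // -subr_ge0 -pform_exp => /le_lt_trans /(_ H).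
  by rewrite ltxx.
have mx z : psd z -> z <= sup S by move=> h; apply: ub_le_sup => //; case: hS.
exists (sup S); split => //.
  by have [z z1 Pz] := psd_extend P1 d1; apply: lt_le_trans z1 (mx _ Pz).
apply/eqP/negP => /negP d0; have [z z1 /mx] := psd_extend P0 d0.
by rewrite leNgt z1.
Qed.

End Pencil.

(** * Reality of the zeros of pencil determinants *)

Section RealRoots.
Import Order.TTheory GRing.Theory Num.Theory.
Local Open Scope complex_scope.
Local Open Scope ring_scope.
Set Implicit Arguments.
Unset Strict Implicit.
Unset Printing Implicit Defensive.

(** Pairing a null vector v with its conjugate gives T = x S, where T is the D-weighted squared norm
    of v, hence positive, and S is real because A is symmetric; so x is a quotient of reals. *)
Lemma pencil_real_root (R : realType) N (D : 'I_N -> R) (A : 'I_N -> 'I_N -> R)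
    (x : R[i]) :
  (forall i, 0 < D i) -> (forall i j, A i j = A j i) ->
  root (map_poly (real_complex R) (\det (pencil_mx D A))) x ->
  x \is Num.real.
Proof.
move=> D0 As; rewrite -det_map_mx /root.
rewrite -[(\det _).[x]]/(horner_eval x (\det _)) -det_map_mx.
case/det0P => v /rV0Pn[i0 vi0] Hv.
have E j : (D j)%:C * v 0 j = x * \sum_i (A i j)%:C * v 0 i.
  have := congr1 (fun M : 'rV_N => M 0 j) Hv; rewrite !mxE.
  rewrite (eq_bigr (fun i => v 0 i * (D i)%:C *+ (i == j) - x * ((A i j)%:C * v 0 i))).
    rewrite sumrB -mulr_sumr (bigD1 j) //= eqxx big1 ?addr0.
      by move/eqP; rewrite subr_eq0 mulrC => /eqP.
    by move=> i /negPf ->.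
  move=> i _; rewrite !mxE /horner_eval rmorphB rmorphM /= rmorphMn /= map_polyX !map_polyC.
  rewrite /horner_eval hornerD hornerN hornerMn hornerM !hornerE /=.
  by case: eqP => _ /=; rewrite ?mulr0n ?mulr1n; ring.
pose T := \sum_j (D j)%:C * (v 0 j * (v 0 j)^*).
pose S := \sum_j \sum_i (A i j)%:C * (v 0 i * (v 0 j)^*).
have TS : T = x * S.
  rewrite /T /S mulr_sumr; apply: eq_bigr => j _.
  rewrite mulrA E -mulrA mulr_suml; congr (_ * _); apply: eq_bigr => i _; ring.
have T0 : 0 < T.
  rewrite /T (bigD1 i0) //=; apply: ltr_pwDl.
    by rewrite mulr_gt0 ?ltcR // -normCK exprn_gt0 // normr_gt0.
  by apply: sumr_ge0 => i _; apply: mulr_ge0; [rewrite lecR ltW | rewrite -normCK exprn_ge0].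
have Sr : S \is Num.real.
  apply/CrealP; rewrite /S rmorph_sum /= exchange_big; apply: eq_bigr => j _ /=.
  rewrite rmorph_sum; apply: eq_bigr => i _ /=.
  rewrite !rmorphM /= conjCK As [_ * v 0 j]mulrC; congr (_ * _).
  by apply/CrealP; rewrite complex_real.
have Sn0 : S != 0.
  by apply/negP => /eqP S0; move: T0; rewrite TS S0 mulr0 ltxx.
have -> : x = T / S by rewrite TS mulfK.
by rewrite rpred_div // ger0_real // ltW.
Qed.

Lemma minor_pencil_mx (R : realType) N (D : 'I_N -> R) (A : 'I_N -> 'I_N -> R) k :
  row' k (col' k (pencil_mx D A)) =
  pencil_mx (fun i => D (lift k i)) (fun i j => A (lift k i) (lift k j)).
Proof. by apply/matrixP => i j; rewrite !mxE (inj_eq lift_inj). Qed.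

(** A diagonal cofactor is again the determinant of a pencil, so the results on pencils, reality of
    zeros included, apply to the numerator of f. *)
Lemma adj_pencil_diag (R : realType) N (D : 'I_N -> R) (A : 'I_N -> 'I_N -> R) k :
  \adj (pencil_mx D A) k k =
  \det (pencil_mx (fun i => D (lift k i)) (fun i j => A (lift k i) (lift k j))).
Proof. by rewrite mxE /cofactor minor_pencil_mx addnn -signr_odd odd_double mul1r. Qed.

End RealRoots.

(** * Homogenization along a rational map *)

Section Homogenize.
Import Order.TTheory GRing.Theory Num.Theory.
Local Open Scope ring_scope.
Set Implicit Arguments.
Unset Strict Implicit.
Unset Printing Implicit Defensive.

Lemma poly_eq0_ext (F : numFieldType) (p : {poly F}) (x : nat -> F) :
  injective x -> (forall n, p.[x n] = 0) -> p = 0.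
Proof.
move=> xi H; apply/eqP/negP => /negP p0.
have := max_poly_roots p0 (rs := [seq x i | i <- iota 0 (size p)]) _ _.
rewrite size_map size_iota ltnn => h; suff : false by []; apply: h.
  by apply/allP => _ /mapP[i _ ->]; rewrite /root H eqxx.
by rewrite map_inj_uniq // iota_uniq.
Qed.

Lemma poly_eq_ext (F : numFieldType) (a p q : {poly F}) : a != 0 ->
  (forall x, a.[x] != 0 -> p.[x] = q.[x]) -> p = q.
Proof.
move=> a0 H; have : a * (p - q) = 0.
  apply: (@poly_eq0_ext _ _ (fun n => n%:R)) => [m n /eqP|n].
    by rewrite eqr_nat => /eqP.
  rewrite hornerM hornerD hornerN.
  have [->|/H ->] := eqVneq a.[n%:R] 0; first by rewrite mul0r.
  by rewrite subrr mulr0.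
by move/eqP; rewrite mulf_eq0 (negPf a0) subr_eq0 => /eqP.
Qed.

(* The polynomial [a ^ m * p (b / a)], also meaningful where [a] vanishes. *)
Definition hom (F : fieldType) (a b : {poly F}) (m : nat) (p : {poly F}) : {poly F} :=
  \sum_(i < m.+1) p`_i *: (b ^+ i * a ^+ (m - i)).

Lemma hom_eval (F : fieldType) (a b : {poly F}) m (p : {poly F}) x : (size p <= m.+1)%N ->
  a.[x] != 0 -> (hom a b m p).[x] = a.[x] ^+ m * p.[b.[x] / a.[x]].
Proof.
move=> sp ax; rewrite (horner_coef_wide _ sp) horner_sum mulr_sumr.
apply: eq_bigr => i _; rewrite hornerZ hornerM !horner_exp [RHS]mulrCA; congr (_ * _).
rewrite expr_div_n mulrCA; congr (_ * _).
by rewrite expfB_cond // (negPf ax) add0n -ltnS.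
Qed.

(** The value at a point where b / a is infinite: only the coefficient of formal degree m
    survives. *)
Lemma hom_eval0 (F : fieldType) (a b : {poly F}) m p x :
  a.[x] = 0 -> (hom a b m p).[x] = p`_m * b.[x] ^+ m.
Proof.
move=> ax; rewrite /hom horner_sum big_ord_recr /= big1 ?add0r.
  by rewrite hornerZ hornerM !horner_exp subnn expr0 mulr1.
move=> i _; rewrite hornerZ hornerM !horner_exp ax expr0n subn_eq0 leqNgt ltn_ord.
by rewrite !mulr0.
Qed.

Section Hom.
Variables (F : numFieldType) (a b : {poly F}).
Hypothesis a0 : a != 0.

Lemma homM m1 m2 (p q : {poly F}) : (size p <= m1.+1)%N -> (size q <= m2.+1)%N ->
  hom a b (m1 + m2) (p * q) = hom a b m1 p * hom a b m2 q.
Proof.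
move=> sp sq; apply: (poly_eq_ext a0) => x ax.
have spq : (size (p * q)%R <= (m1 + m2).+1)%N.
  apply: leq_trans (size_polyMleq _ _) _.
  by rewrite -subn1 leq_subLR add1n -addSn -addnS leq_add.
by rewrite hornerM !hom_eval // exprD hornerM mulrACA.
Qed.

Lemma hom1 m : hom a b m 1 = a ^+ m.
Proof.
apply: (poly_eq_ext a0) => x ax.
by rewrite hom_eval ?size_poly1 // hornerC mulr1 horner_exp.
Qed.

Lemma homD m d (p : {poly F}) : (size p <= m.+1)%N -> hom a b (d + m) p = a ^+ d * hom a b m p.
Proof. by move=> sp; rewrite -{1}[p]mul1r homM ?size_poly1 // hom1. Qed.

Lemma homZ m c p : hom a b m (c *: p) = c *: hom a b m p.
Proof.
rewrite /hom scaler_sumr; apply: eq_bigr => i _.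
by rewrite coefZ scalerA.
Qed.

Lemma hom_XsubC s : hom a b 1 ('X - s%:P) = b - s *: a.
Proof.
apply: (poly_eq_ext a0) => x ax; rewrite hom_eval ?size_XsubC // !hornerE.
by field.
Qed.

Lemma hom_prod rs : hom a b (size rs) (\prod_(s <- rs) ('X - s%:P)) =
  \prod_(s <- rs) (b - s *: a).
Proof.
elim: rs => [|s rs IH]; first by rewrite !big_nil hom1 expr0.
rewrite !big_cons /= -add1n homM ?size_XsubC ?size_prod_XsubC //.
by rewrite hom_XsubC IH.
Qed.

Lemma hom_scale (g : {poly F}) m (p : {poly F}) : (size p <= m.+1)%N -> g != 0 ->
  hom (g * a) (g * b) m p = g ^+ m * hom a b m p.
Proof.
move=> sp g0; apply: (poly_eq_ext (a := g * a)) => [|x]; first by rewrite mulf_neq0.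
rewrite hornerM mulf_eq0 negb_or => /andP[gx ax].
rewrite hornerM hom_eval //; last by rewrite hornerM mulf_neq0.
rewrite hom_eval // horner_exp !hornerM exprMn -mulrA; congr (_ * (_ * _.[_])).
by field; rewrite gx ax.
Qed.

End Hom.
(** Over an algebraically closed field [hom] is, up to a constant, a power of a times the product of
    b - s a over the roots s of p. *)
Lemma hom_neq0 (F : numClosedFieldType) (a b : {poly F}) m (p : {poly F}) : a != 0 ->
  (forall s, b - s *: a != 0) -> (size p <= m.+1)%N -> p != 0 -> hom a b m p != 0.
Proof.
move=> a0 H sp p0; have [rs E] := closed_field_poly_normal p.
have srs : size p = (size rs).+1 by rewrite E size_scale ?lead_coef_eq0 // size_prod_XsubC.
have le : (size rs <= m)%N by rewrite -ltnS -srs.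
rewrite -(subnK le) homD ?srs // mulf_neq0 ?expf_neq0 // E homZ hom_prod //.
rewrite scaler_eq0 lead_coef_eq0 (negPf p0) /= prodf_seq_neq0.
by apply/allP => s _ /=.
Qed.

(** Infinite descent measured by the number of entries of [rs] below f s. The embedding f is there
    because the roots are listed in the complex field while the descent is along the order of the
    reals. *)
Lemma no_descent (R : realType) (F : numFieldType) (f : {rmorphism R -> F}) (rs : seq F)
    (Pr : R -> Prop) :
  {mono f : x y / x < y} -> (forall s, Pr s -> f s \in rs /\ exists2 s', Pr s' & s' < s) ->
  forall s, ~ Pr s.
Proof.
move=> fm H; suff : forall n s, (count (fun x => (x < f s)%R) rs < n)%N -> ~ Pr s.
  by move=> h s; apply: (h _ s (ltnSn _)).
elim=> // n IH s; rewrite ltnS => cn Ps.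
(* The second use of [H] shows that f s' itself is listed, which makes the count drop strictly. *)
have [_ [s' Ps' s's]] := H s Ps; have [ms' _] := H s' Ps'.
apply: (IH s') => //; apply: leq_trans cn.
have : (count (fun x => (x < f s')%R) rs + count (pred1 (f s')) rs <= count (fun x => (x < f s)%R) rs)%N.
  rewrite -count_predUI -[X in (_ <= X)%N]addn0; apply: leq_add; last first.
    rewrite leqn0; apply/eqP; rewrite -(count_pred0 rs); apply: eq_count => x /=.
    by case: eqP => [->|]; rewrite ?ltxx ?andbF.
  apply: sub_count => x /= /orP[h|/eqP ->]; last by rewrite fm.
  by apply: lt_trans h _; rewrite fm.
by apply: leq_trans; rewrite -addn1 leq_add2l -has_count has_pred1.
Qed.

End Homogenize.

(** * Rational solutions of A = f^n (A o d) *)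

Section RationalSolution.
Import Order.TTheory GRing.Theory Num.Theory.
Local Open Scope complex_scope.
Local Open Scope ring_scope.
Set Implicit Arguments.
Unset Strict Implicit.
Unset Printing Implicit Defensive.

Lemma size_prod_gt (F : idomainType) (f : F -> {poly F}) (rs : seq F) :
  (forall s, s \in rs -> (2 < size (f s))%N) ->
  (size rs * 2 < size (\prod_(s <- rs) f s)%R)%N.
Proof.
elim: rs => [|s rs IH] H; first by rewrite big_nil size_poly1.
have IH' : (size rs * 2 < size (\prod_(s <- rs) f s)%R)%N.
  by apply: IH => x h; apply: H; rewrite in_cons h orbT.
have Hs := H s (mem_head _ _).
have aux x y z : (2 < x -> z * 2 < y -> z.+1 * 2 < (x + y).-1)%N by clear; lia.
rewrite big_cons size_mul -?size_poly_gt0; first exact: aux.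
  exact: leq_ltn_trans Hs.
exact: leq_ltn_trans IH'.
Qed.

Lemma mup_pm1 (F : numFieldType) (c : F) i j : c != 0 ->
  mup 1 (c *: (('X - 1%:P) ^+ i * ('X + 1%:P) ^+ j)) = i /\
  mup (-1) (c *: (('X - 1%:P) ^+ i * ('X + 1%:P) ^+ j)) = j.
Proof.
move=> c0; have two0 : (1 + 1 : F) != 0 by rewrite -[1 + 1]/(2%:R) pnatr_eq0.
have -> : 'X + 1%:P = 'X - (-1)%:P :> {poly F} by rewrite rmorphN opprK.
have cr x : ~~ root c%:P x by rewrite /root hornerC.
rewrite -mul_polyC; split; rewrite mupMr //.
  rewrite mupMl ?mup_XsubCX ?eqxx // /root horner_exp hornerXsubC expf_eq0 opprK.
  by rewrite (negPf two0) andbF.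
rewrite mupMr ?mup_XsubCX ?eqxx // /root horner_exp hornerXsubC expf_eq0.
by rewrite -opprD oppr_eq0 (negPf two0) andbF.
Qed.

(** In this section d = pb / pa, f = pD / pa and pk / pa = (1 - d) / (1 - z), so pk(1) / pa(1) is
    d'(1). The rational function A is P / Q in lowest terms, m bounds both degrees, and [feq] is A =
    f^n (A o d) after clearing denominators. *)
Variables (R : realType) (pa pb pD pk : {poly R}) (z0 : R).
Local Notation C := R[i].
Local Notation toC := (map_poly (real_complex R)).
Local Notation a := (toC pa).
Local Notation b := (toC pb).
Local Notation D := (toC pD).
Hypotheses (pa0 : pa.[0] != 0) (pbX2 : exists q, pb = 'X^2 * q)
  (pk_eq : pa - pb = (1 - 'X) * pk)
  (z0_gt1 : 1 < z0) (pa_z0 : pa.[z0] = 0) (pb_z0 : pb.[z0] != 0) (pD_z0 : pD.[z0] != 0)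
  (pa_gt0 : forall z, 0 <= z -> z < z0 -> 0 < pa.[z])
  (pD_gt0 : forall z, 0 <= z -> z < z0 -> 0 < pD.[z])
  (pb_ge0 : forall z, 0 <= z -> z < z0 -> 0 <= pb.[z])
  (pb_lt : forall z, 0 < z -> z < 1 -> pb.[z] < z * pa.[z])
  (pre : forall s, 1 < s -> exists z, [/\ 1 < z, z < z0, z < s & pb.[z] = s * pa.[z]])
  (pD_real : forall x, root D x -> x \is Num.real).
Variables (n m : nat) (P Q : {poly C}).
Hypotheses (n_gt0 : (0 < n)%N) (copPQ : coprimep P Q) (Q_neq0 : Q != 0) (P_neq0 : P != 0)
  (sP : (size P <= m.+1)%N) (sQ : (size Q <= m.+1)%N)
  (feq : a ^+ n * P * hom a b m Q = D ^+ n * Q * hom a b m P)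
  (evenPQ : P * (Q \Po - 'X) = (P \Po - 'X) * Q).

Lemma toC_eval (p : {poly R}) x : (toC p).[x%:C] = p.[x]%:C.
Proof. by rewrite horner_map. Qed.

Lemma toC_real (p : {poly R}) x : x \is Num.real -> (toC p).[x] \is Num.real.
Proof. by move=> /complex_realP[k ->]; rewrite toC_eval; apply/complex_realP; eexists. Qed.

Lemma pa_neq0 : pa != 0. Proof. by apply/negP => /eqP h; move: pa0; rewrite h horner0 eqxx. Qed.
Lemma a_neq0 : a != 0. Proof. by rewrite map_poly_eq0 pa_neq0. Qed.
Lemma pb0 : pb.[0] = 0.
Proof. by have [q ->] := pbX2; rewrite hornerM hornerXn expr0n mul0r. Qed.
Lemma pb_neq0 : pb != 0.
Proof. by apply/negP => /eqP h; move: pb_z0; rewrite h horner0 eqxx. Qed.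
Lemma a0_neq0 : a.[0] != 0.
Proof. by rewrite -[0]/(0%:C) toC_eval (inj_eq (@complexI R)). Qed.
Lemma b0_eq0 : b.[0] = 0.
Proof. by rewrite -[0]/(0%:C) toC_eval pb0. Qed.
Lemma D0_neq0 : D.[0] != 0.
Proof.
rewrite -[0]/(0%:C) toC_eval (inj_eq (@complexI R)) gt_eqF // pD_gt0 //.
exact: lt_trans z0_gt1.
Qed.

Lemma P_root x : root Q x -> P.[x] != 0.
Proof. by apply: coprimep_root; rewrite coprimep_sym. Qed.

(** At a pole s of A the right side of [feq] vanishes, while a(s) and P(s) do not: poles move
    forward along d. *)
Lemma root_forward s : root Q s -> a.[s] != 0 -> root Q (b.[s] / a.[s]).
Proof.
move=> Qs as0; have /(congr1 (horner^~ s)) := feq.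
rewrite !hornerM (rootP Qs) mulr0 mul0r => /eqP.
rewrite !mulf_eq0 horner_exp expf_eq0 (negPf as0) andbF (negPf (P_root Qs)) /=.
by rewrite hom_eval // mulf_eq0 expf_eq0 (negPf as0) andbF.
Qed.

(** Poles also move backward, provided that x is not a zero of f, which could absorb the pole of A o
    d. *)
Lemma root_backward x : a.[x] != 0 -> D.[x] != 0 -> root Q (b.[x] / a.[x]) -> root Q x.
Proof.
move=> ax Dx Qx; have /(congr1 (horner^~ x)) := feq.
rewrite !hornerM [(hom a b m Q).[x]]hom_eval // (rootP Qx) !mulr0 => /esym/eqP.
rewrite !mulf_eq0 horner_exp expf_eq0 (negPf Dx) andbF /= => /orP[|] //.
by rewrite hom_eval // mulf_eq0 expf_eq0 (negPf ax) andbF (negPf (P_root Qx)).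
Qed.

Lemma root_opp x : root Q x -> root Q (- x).
Proof.
move=> Qx; have /(congr1 (horner^~ x)) := evenPQ.
rewrite !hornerM (rootP Qx) mulr0 => /eqP; rewrite mulf_eq0 (negPf (P_root Qx)) /=.
by rewrite horner_comp hornerN hornerX.
Qed.

(** The point 0 is fixed by d with multiplicity at least 2, and f is finite and nonzero there; a
    pole of order j of A at 0 would become one of order at least 2 j of f^n (A o d). *)
Lemma Q0 : ~~ root Q 0.
Proof.
apply/negP => Q0; have P0 := P_root Q0.
have [j [Q' Q'0 E]] := multiplicity_XsubC Q 0.
rewrite Q_neq0 /= in Q'0; rewrite polyC0 subr0 in E.
have j0 : (0 < j)%N.
  rewrite lt0n; apply/negP => /eqP j0; move: Q'0.
  by rewrite -[Q']mulr1 -(expr0 'X) -j0 -E Q0.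
have Q'n0 : Q' != 0 by apply/negP => /eqP h; move: Q'0; rewrite h root0.
have sE : size Q = (size Q' + j)%N by rewrite E size_Mmonic ?monicXn // size_polyXn addnS.
have jm : (j <= m)%N.
  rewrite -ltnS; apply: leq_trans sQ; rewrite sE -addn1 addnC leq_add2r.
  by rewrite lt0n size_poly_eq0.
have [q bq] := pbX2.
have bE : b = 'X^2 * toC q by rewrite bq rmorphM /= rmorphXn /= map_polyX.
have hj : hom a b j ('X ^+ j) = b ^+ j.
  have := hom_prod b a_neq0 (nseq j 0); rewrite size_nseq !big_nseq !iter_mulr_1.
  by rewrite polyC0 subr0 scale0r subr0.
have hQ : hom a b m Q = b ^+ j * hom a b (m - j) Q'.
  rewrite -hj -homM ?a_neq0 ?size_polyXn //; first by rewrite subnKC // mulrC -E.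
  by rewrite -subSn // leq_subRL ?(leqW jm) // addnC -sE.
have := feq; rewrite hQ [in X in _ = X * _]E.
set h1 := hom a b (m - j) Q'; set h2 := hom a b m P; rewrite [in b ^+ j]bE => feq'.
have Xj : 'X^j != 0 :> {poly C} by rewrite monic_neq0 ?monicXn.
have : 'X^j * ('X^j * (a ^+ n * P * toC q ^+ j * h1)) = 'X^j * (D ^+ n * Q' * h2).
  have -> : 'X^j * (D ^+ n * Q' * h2) = D ^+ n * (Q' * 'X^j) * h2 by ring.
  by rewrite -feq' exprMn -exprM mulnC mulnC mulSn mul1n exprD; ring.
move/(mulfI Xj) => /(congr1 (horner^~ 0)); rewrite /h2.
rewrite !hornerM hornerXn expr0n gtn_eqF //= !mul0r => /esym/eqP.
rewrite !mulf_eq0 horner_exp expf_eq0 (negPf D0_neq0) andbF /=.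
rewrite -[_ == 0]/(root Q' 0) (negPf Q'0) /= hom_eval ?a0_neq0 //.
by rewrite b0_eq0 mul0r mulf_eq0 expf_eq0 (negPf a0_neq0) andbF (negPf P0).
Qed.

Lemma roots_seq : exists rs : seq C, forall x, root Q x -> x \in rs.
Proof.
have [rs E] := closed_field_poly_normal Q; exists rs => x.
by rewrite E rootZ ?lead_coef_eq0 // root_prod_XsubC.
Qed.

Lemma a_real_neq0 x : 0 <= x -> x < z0 -> a.[x%:C] != 0.
Proof. by move=> h h'; rewrite toC_eval (inj_eq (@complexI R)) gt_eqF // pa_gt0. Qed.

Lemma D_real_neq0 x : 0 <= x -> x < z0 -> D.[x%:C] != 0.
Proof. by move=> h h'; rewrite toC_eval (inj_eq (@complexI R)) gt_eqF // pD_gt0. Qed.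

Lemma no_root_lt1 (s : R) : 0 < s -> s < 1 -> ~~ root Q s%:C.
Proof.
move=> s0 s1; apply/negP => Qs; have [rs Hrs] := roots_seq.
apply: (@no_descent R C (real_complex R) rs (fun s => [/\ 0 < s, s < 1 & root Q s%:C])
  _ _ s) => [x y|{s0 s1 Qs}s [s0 s1 Qs]|//]; first exact: ltcR.
split; first exact: Hrs.
have sz : s < z0 by apply: lt_trans z0_gt1.
have fw := root_forward Qs (a_real_neq0 (ltW s0) sz).
rewrite !toC_eval -fmorphV -rmorphM /= in fw.
have lt_s : pb.[s] / pa.[s] < s by rewrite ltr_pdivrMr ?pa_gt0 ?pb_lt // ltW.
exists (pb.[s] / pa.[s]) => //; split => //; last exact: lt_trans s1.
rewrite lt_def divr_ge0 ?pb_ge0 ?(ltW (pa_gt0 _ _)) ?(ltW s0) // andbT.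
by apply/negP => /eqP h; move: Q0; rewrite -[0]/(0%:C) -h fw.
Qed.

Lemma no_root_gt1 (s : R) : 1 < s -> ~~ root Q s%:C.
Proof.
move=> s1; apply/negP => Qs; have [rs Hrs] := roots_seq.
apply: (@no_descent R C (real_complex R) rs (fun s => 1 < s /\ root Q s%:C)
  _ _ s) => [x y|{s1 Qs}s [s1 Qs]|//]; first exact: ltcR.
split; first exact: Hrs.
have [z [z1 zz0 zs E]] := pre s1; exists z => //; split => //.
have zp : 0 <= z by rewrite ltW // (lt_trans ltr01).
apply: root_backward; [exact: a_real_neq0|exact: D_real_neq0|].
by rewrite !toC_eval E -fmorphV -rmorphM /= mulfK // gt_eqF // pa_gt0.
Qed.

(** * Non-real poles *)

Section Nonreal.
(** At a common zero of pa and pb the equation pb = s pa would hold for every s, so preimages are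
    counted with d in lowest terms V / U. *)
Let g := gcdp pa pb.
Let U := pa %/ g.
Let V := pb %/ g.

Lemma gU_E : pa = g * U. Proof. by rewrite mulrC divpK // dvdp_gcdl. Qed.
Lemma gV_E : pb = g * V. Proof. by rewrite mulrC divpK // dvdp_gcdr. Qed.
Lemma copUV : coprimep (toC U) (toC V).
Proof. by rewrite coprimep_map coprimep_div_gcd // pa_neq0. Qed.
Lemma g_neq0 : g != 0.
Proof. by apply/negP => /eqP h; move: pa_neq0; rewrite gU_E h mul0r eqxx. Qed.
Lemma U_neq0 : U != 0.
Proof. by apply/negP => /eqP h; move: pa_neq0; rewrite gU_E h mulr0 eqxx. Qed.
Lemma V_neq0 : V != 0.
Proof. by apply/negP => /eqP h; move: pb_neq0; rewrite gV_E h mulr0 eqxx. Qed.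

Lemma size_V : (2 < size V)%N.
Proof.
have X2V : 'X^2 %| V.
  have cop : coprimep ('X^2 : {poly R}) g.
    rewrite coprimep_expl // coprimep_sym -[X in coprimep _ X]subr0 -polyC0 coprimep_XsubC /root.
    by apply/negP => /eqP h; move: pa0; rewrite gU_E hornerM h mul0r eqxx.
  rewrite -(Gauss_dvdpr _ cop) -gV_E; have [q ->] := pbX2; exact: dvdp_mulr.
by have := dvdp_leq V_neq0 X2V; rewrite size_polyXn.
Qed.

(** U and V are real, so the top coefficient of V cannot cancel against a non-real multiple of U.
    Each non-real s thus has at least two preimages, with multiplicities. *)
Lemma size_VsU s : s \isn't Num.real -> (2 < size (toC V - s *: toC U)%R)%N.
Proof.
move=> sn; apply: leq_trans (_ : size V <= _)%N; first exact: size_V.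
rewrite leqNgt; apply/negP => h.
have h' : (size (toC V - s *: toC U)%R <= (size V).-1)%N.
  by rewrite -ltnS prednK // lt0n size_poly_eq0 V_neq0.
have := nth_default 0 h'; rewrite coefB coefZ !coef_map /=.
have := V_neq0; rewrite -lead_coef_eq0 lead_coefE.
set v := V`_ _; set u := U`_ _ => v0 /eqP; rewrite subr_eq0 => /eqP E.
have u0 : u != 0.
  by apply/negP => /eqP u0; move: E v0; rewrite u0 mulr0 => /complexI ->; rewrite eqxx.
move/negP: sn; apply; apply/complex_realP; exists (v / u).
by rewrite rmorphM fmorphV /= E mulfK // (inj_eq (@complexI R)).
Qed.

(** Let Q1 carry the c non-real roots of Q with multiplicities, and let H be the product of V - s U
    over them. A root of H is non-real, since d maps reals to reals, so it is a zero neither of D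
    nor of the remaining factor Q2 of Q; nor is it a zero of hom P, which is there P(s) times a
    power of U. Hence H divides Q1, although its degree is at least 2 c; so c = 0. *)
Lemma Q_roots_real x0 : root Q x0 -> x0 \is Num.real.
Proof.
have [rs E] := closed_field_poly_normal Q.
pose r1 := [seq x <- rs | x \isn't Num.real]; pose r2 := [seq x <- rs | x \is Num.real].
pose Q1 := \prod_(s <- r1) ('X - s%:P); pose Q2 := lead_coef Q *: \prod_(s <- r2) ('X - s%:P).
have lQ : lead_coef Q != 0 by rewrite lead_coef_eq0.
have QE : Q = Q1 * Q2.
  rewrite {1}E /Q1 /Q2 -scalerAr; congr (_ *: _).
  by rewrite /r1 /r2 !big_filter [LHS](bigID (fun s => s \is Num.real)) mulrC.
have sQ1 : size Q1 = (size r1).+1 by rewrite size_prod_XsubC.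
have Q1n0 : Q1 != 0 by rewrite -size_poly_eq0 sQ1.
have Q2n0 : Q2 != 0 by apply/negP => /eqP h; move: Q_neq0; rewrite QE h mulr0 eqxx.
suff c0 : size r1 = 0%N.
  move=> Qx; have {Qx} : x0 \in rs by move: Qx; rewrite E rootZ // root_prod_XsubC.
  move=> xrs; rewrite -[_ \is _]negbK; apply/negP => xn.
  have : x0 \in r1 by rewrite mem_filter xn.
  by rewrite (size0nil c0).
have sQQ : size Q = (size r1 + size Q2)%N.
  by rewrite QE size_mul // sQ1.
have c_m : (size r1 <= m)%N.
  rewrite -ltnS; apply: leq_trans sQ; rewrite sQQ -addn1 leq_add2l lt0n size_poly_eq0 //.
have tU0 : toC U != 0 by rewrite map_poly_eq0 U_neq0.
have tg0 : toC g != 0 by rewrite map_poly_eq0 g_neq0.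
have aE : a = toC g * toC U by rewrite -rmorphM /= -gU_E.
have bE : b = toC g * toC V by rewrite -rmorphM /= -gV_E.
pose H := \prod_(s <- r1) (toC V - s *: toC U).
have hQ : hom (toC U) (toC V) m Q = H * hom (toC U) (toC V) (m - size r1) Q2.
  rewrite /H -hom_prod // -homM ?sQ1 //; first by rewrite subnKC // -QE.
  by rewrite -subSn // leq_subRL ?(leqW c_m) // -sQQ.
have feq' : a ^+ n * P * hom (toC U) (toC V) m Q = D ^+ n * Q * hom (toC U) (toC V) m P.
  apply: (mulfI (x := toC g ^+ m)); first by rewrite expf_neq0.
  rewrite mulrCA -hom_scale // -aE -bE feq mulrCA; congr (_ * _).
  by rewrite aE bE hom_scale.
have HQ1 : H %| Q1.
  rewrite -(@Gauss_dvdpr _ _ (D ^+ n * Q2 * hom (toC U) (toC V) m P)).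
    apply/dvdpP; exists (a ^+ n * P * hom (toC U) (toC V) (m - size r1) Q2).
    have -> : D ^+ n * Q2 * hom (toC U) (toC V) m P * Q1 = D ^+ n * Q * hom (toC U) (toC V) m P.
      by rewrite QE; ring.
    by rewrite -feq' hQ; ring.
  apply: Pdiv.ClosedField.root_coprimep => x; rewrite /H /root horner_prod prodf_seq_eq0.
  case/hasP => s sr1 /=; rewrite hornerD hornerN hornerZ subr_eq0 => /eqP Vx.
  have sn : s \isn't Num.real by move: sr1; rewrite mem_filter => /andP[].
  have srt : root Q s by rewrite E rootZ // root_prod_XsubC; move: sr1; rewrite mem_filter => /andP[].
  have Ux : (toC U).[x] != 0.
    apply/negP => /eqP Ux; have := coprimep_root copUV (x := x); rewrite /root Ux eqxx.
    by move=> /(_ isT); rewrite Vx Ux mulr0 eqxx.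
  have sE : s = (toC V).[x] / (toC U).[x] by rewrite Vx mulfK.
  have xn : x \isn't Num.real.
    by apply/negP => xr; move/negP: sn; apply; rewrite sE rpred_div // toC_real.
  rewrite !hornerM !mulf_neq0 ?horner_exp ?expf_neq0 //.
  - by apply/negP => Dx; move/negP: xn; apply; apply: pD_real.
  - rewrite /Q2 hornerZ mulf_neq0 // horner_prod prodf_seq_neq0.
    apply/allP => y /=; rewrite mem_filter => /andP[yr _].
    rewrite hornerXsubC subr_eq0; apply/negP => /eqP xy.
    by move/negP: xn; apply; rewrite xy.
  - by rewrite hom_eval // -sE mulf_neq0 ?expf_neq0 // P_root.
have nz s : s \in r1 -> toC V - s *: toC U != 0.
  rewrite mem_filter => /andP[sn _]; rewrite -size_poly_gt0.
  by apply: leq_trans (size_VsU sn).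
have sH : (size r1 * 2 < size H)%N.
  apply: size_prod_gt => s; rewrite mem_filter => /andP[sn _]; exact: size_VsU.
have := leq_trans sH (dvdp_leq Q1n0 HQ1).
by rewrite sQ1 ltnS; case: (size r1) => // c; rewrite muln2 -addnn leqNgt ltnS leq_addl.
Qed.

End Nonreal.

Lemma Q_roots x : root Q x -> x = 1 \/ x = -1.
Proof.
have pos (y : R) : 0 < y -> root Q y%:C -> y = 1.
  move=> y0 Qy; case: (ltgtP y 1) => // h.
    by have := no_root_lt1 y0 h; rewrite Qy.
  by have := no_root_gt1 h; rewrite Qy.
move=> Qx; have /complex_realP[y E] := Q_roots_real Qx; rewrite E in Qx *.
case: (ltgtP y 0) => h; last by move: Q0; rewrite -[0]/(0%:C) -h Qx.
  right; have := pos (- y); rewrite oppr_gt0 => /(_ h) H.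
  have yE : - y = 1 by apply: H; rewrite rmorphN /=; exact: root_opp.
  by rewrite -[y]opprK yE rmorphN.
by left; rewrite (pos y h Qx).
Qed.

(** P is coprime to Q, so evenness of P / Q makes Q divide its reflection Q(-X); comparing
    multiplicities at 1 and at -1 gives an inequality between the two exponents in each
    direction. *)
Lemma Q_form : exists k, Q = lead_coef Q *: (('X - 1%:P) ^+ k * ('X + 1%:P) ^+ k).
Proof.
have [rs E] := closed_field_poly_normal Q.
have lQ : lead_coef Q != 0 by rewrite lead_coef_eq0.
have rsE s : s \in rs -> s = 1 \/ s = -1.
  by move=> h; apply: Q_roots; rewrite E rootZ // root_prod_XsubC.
have [k [k' E']] : exists k k', \prod_(s <- rs) ('X - s%:P) = ('X - 1%:P) ^+ k * ('X + 1%:P) ^+ k' :> {poly C}.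
  elim: rs rsE {E} => [|s rs IH] H; first by exists 0%N, 0%N; rewrite big_nil mul1r.
  have [|k [k' E]] := IH; first by move=> x h; apply: H; rewrite in_cons h orbT.
  rewrite big_cons E; case: (H s (mem_head _ _)) => ->.
    by exists k.+1, k'; rewrite exprS mulrA.
  by exists k, k'.+1; rewrite rmorphN opprK exprS mulrCA.
suff kk : k = k' by exists k; rewrite {1}E E' kk.
have dQ : Q %| Q \Po (- 'X).
  rewrite -(@Gauss_dvdpr _ _ P); last by rewrite coprimep_sym.
  by rewrite evenPQ dvdp_mull.
have QE : Q = lead_coef Q *: (('X - 1%:P) ^+ k * ('X + 1%:P) ^+ k') by rewrite -E'.
have QoE : Q \Po (- 'X) = (lead_coef Q * (-1) ^+ k * (-1) ^+ k') *: (('X - 1%:P) ^+ k' * ('X + 1%:P) ^+ k).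
  rewrite {1}QE comp_polyZ (rmorphM (comp_poly _)) !(rmorphXn (comp_poly _)) /=.
  rewrite comp_polyB comp_polyD comp_polyX !comp_polyC.
  have -> : - 'X - 1%:P = (-1)%:P * ('X + 1%:P) :> {poly C} by rewrite rmorphN mulN1r opprD.
  have -> : - 'X + 1%:P = (-1)%:P * ('X - 1%:P) :> {poly C} by rewrite rmorphN mulN1r opprB addrC.
  rewrite !exprMn -!mul_polyC !rmorphM !rmorphXn /=; ring.
have cn : lead_coef Q * (-1) ^+ k * (-1) ^+ k' != 0 by rewrite !mulf_neq0 ?expf_neq0 ?oppr_eq0 ?oner_eq0.
have [e1 e2] := mup_pm1 k' k cn; rewrite -QoE in e1 e2.
have Qo0 : Q \Po - 'X != 0.
  rewrite QoE scaler_eq0 (negPf cn) mulf_neq0 ?expf_neq0 ?polyXsubC_eq0 //.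
  by rewrite -[1%:P]opprK -rmorphN polyXsubC_eq0.
have d1 : ('X - 1%:P) ^+ k %| Q \Po - 'X.
  by apply: dvdp_trans dQ; rewrite QE dvdpZr // dvdp_mulr.
have d2 : ('X - (-1)%:P) ^+ k' %| Q \Po - 'X.
  by apply: dvdp_trans dQ; rewrite QE dvdpZr // rmorphN opprK dvdp_mull.
rewrite -mup_geq // e1 in d1; rewrite -mup_geq // e2 in d2.
by apply/eqP; rewrite eqn_leq d1.
Qed.

(** At z0 both f and d have a pole, of the order e of the zero of a. So f^n (A o d) has a pole of
    order (n + deg P - deg Q) e, and this number cannot be positive because A has no pole beyond
    1. *)
Lemma degQ_ge : (n < size Q)%N.
Proof.
rewrite ltnNge; apply/negP => h.
pose q := (size Q).-1; pose p := (size P).-1.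
have qS : size Q = q.+1 by rewrite prednK // lt0n size_poly_eq0.
have pS : size P = p.+1 by rewrite prednK // lt0n size_poly_eq0.
have qm : (q <= m)%N by rewrite -ltnS -qS.
have pm : (p <= m)%N by rewrite -ltnS -pS.
have az : a.[z0%:C] = 0 by rewrite toC_eval pa_z0.
have bz : b.[z0%:C] != 0 by rewrite toC_eval (inj_eq (@complexI R)).
have Dz : D.[z0%:C] != 0 by rewrite toC_eval (inj_eq (@complexI R)).
have aux x y z t : (x < y -> x <= z -> t <= z -> y + (z - x) = (z - t) + (y - x + t))%N by clear; lia.
have aux2 x y z : (x < y -> 0 < y - x + z)%N by clear; lia.
have := feq; rewrite -[in X in _ * X = _](subnK qm) homD ?qS ?a_neq0 //.
rewrite -[in X in _ = _ * X](subnK pm) homD ?pS ?a_neq0 //.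
have -> : a ^+ n * P * (a ^+ (m - q) * hom a b q Q) = a ^+ (m - p) * (a ^+ (n - q + p) * P * hom a b q Q).
  have e : (n + (m - q) = (m - p) + (n - q + p))%N.
    by apply: aux => //; rewrite -qS.
  have -> : a ^+ n * P * (a ^+ (m - q) * hom a b q Q) = a ^+ n * a ^+ (m - q) * (P * hom a b q Q) by ring.
  rewrite -exprD e exprD; ring.
have -> : D ^+ n * Q * (a ^+ (m - p) * hom a b p P) = a ^+ (m - p) * (D ^+ n * Q * hom a b p P) by ring.
move/(mulfI (expf_neq0 _ a_neq0)) => /(congr1 (horner^~ z0%:C)).
rewrite !hornerM horner_exp az expr0n.
have -> : ((n - q + p)%N == 0) = false.
  by apply/negbTE; rewrite -lt0n; apply: aux2; rewrite -qS.
rewrite !mul0r => /esym/eqP; rewrite !mulf_eq0 horner_exp expf_eq0 (negPf Dz) andbF /=.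
rewrite -[Q.[_] == 0]/(root Q _) (negPf (no_root_gt1 z0_gt1)) /=.
rewrite hom_eval0 // mulf_eq0 expf_eq0 (negPf bz) andbF orbF.
by rewrite -[p]/(size P).-1 -lead_coefE lead_coef_eq0 (negPf P_neq0).
Qed.

(** A comparison of leading terms at the fixed point 1 of d: if A behaves like C (z - 1)^-k, then A
    o d behaves like C d'(1)^-k (z - 1)^-k, and f(1)^n has to compensate. *)
Lemma exponent_relation : exists k, (n <= k.*2)%N /\
  (pk.[1] / pa.[1]) ^+ k = (pD.[1] / pa.[1]) ^+ n.
Proof.
have [k QE] := Q_form.
have lQ : lead_coef Q != 0 by rewrite lead_coef_eq0.
have nz x : ('X + x%:P : {poly C}) != 0 by rewrite -[x]opprK rmorphN polyXsubC_eq0.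
have sX : size (('X - 1%:P : {poly C}) ^+ k) = k.+1 by rewrite size_exp_XsubC.
have sX' : size (('X + 1%:P : {poly C}) ^+ k) = k.+1.
  by rewrite -[1%:P]opprK -rmorphN size_exp_XsubC.
have szQ : size Q = k.*2.+1.
  rewrite QE size_scale // size_mul ?expf_neq0 ?polyXsubC_eq0 // sX sX'.
  by rewrite addnS /= addSn addnn.
have nk : (n <= k.*2)%N by have := degQ_ge; rewrite szQ.
exists k; split => //.
have k0 : (0 < k)%N by have := leq_trans n_gt0 nk; rewrite double_gt0.
have km : (k.*2 <= m)%N by rewrite -ltnS -szQ.
have P1 : P.[1] != 0.
  apply: P_root; rewrite QE rootZ // rootM /root horner_exp hornerXsubC subrr expr0n.
  by rewrite gtn_eqF //= eqxx.
have bma : b - a = ('X - 1%:P) * toC pk.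
  have -> : 'X - 1%:P = - toC (1 - 'X).
    by rewrite polyC1 rmorphB /= map_polyX rmorph1 opprB.
  by rewrite mulNr -rmorphM /= -pk_eq rmorphB opprB.
have hX : hom a b k (('X - 1%:P) ^+ k) = (b - a) ^+ k.
  have := hom_prod b a_neq0 (nseq k 1); rewrite size_nseq !big_nseq !iter_mulr_1.
  by rewrite scale1r.
have hX' : hom a b k (('X + 1%:P) ^+ k) = (b + a) ^+ k.
  have := hom_prod b a_neq0 (nseq k (-1)); rewrite size_nseq !big_nseq !iter_mulr_1.
  by rewrite scaleN1r opprK rmorphN opprK.
have hQ : hom a b m Q = lead_coef Q *: (a ^+ (m - k.*2) * ((b - a) ^+ k * (b + a) ^+ k)).
  rewrite {1}QE homZ -hX -hX' -homM ?a_neq0 ?sX ?sX' // addnn -homD ?a_neq0 ?subnK //.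
  by rewrite -(@size_scale _ (lead_coef Q)) // -QE szQ.
have := feq; rewrite hQ bma [in X in _ = X * _]QE !exprMn.
set K := toC pk.
have -> : a ^+ n * P * (lead_coef Q *: (a ^+ (m - k.*2) * (('X - 1%:P) ^+ k * K ^+ k * (b + a) ^+ k))) =
   ('X - 1%:P) ^+ k * (lead_coef Q *: (a ^+ n * P * (a ^+ (m - k.*2) * (K ^+ k * (b + a) ^+ k)))).
  rewrite -!mul_polyC; ring.
have -> : D ^+ n * (lead_coef Q *: (('X - 1%:P) ^+ k * ('X + 1%:P) ^+ k)) * hom a b m P =
   ('X - 1%:P) ^+ k * (lead_coef Q *: (D ^+ n * ('X + 1%:P) ^+ k * hom a b m P)).
  rewrite -!mul_polyC; ring.
have X0 : ('X - 1%:P : {poly C}) ^+ k != 0 by rewrite expf_neq0 // polyXsubC_eq0.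
move/(mulfI X0)/(scalerI lQ) => /(congr1 (horner^~ 1)).
have pb1 : pb.[1] = pa.[1].
  have /(congr1 (horner^~ 1)) := pk_eq; rewrite hornerM !hornerD !hornerN hornerX hornerC subrr mul0r.
  by move/eqP; rewrite subr_eq0 => /eqP ->.
have a1 : a.[1] != 0 by rewrite -[1]/(1%:C) a_real_neq0.
have b1 : b.[1] = a.[1] by rewrite -[1]/(1%:C) !toC_eval pb1.
rewrite !hornerM !horner_exp hom_eval // !hornerD hornerX hornerC b1 divff //.
rewrite -mulr2n -[1 + 1]/(2%:R) -[a.[1] *+ 2]mulr_natl exprMn => EE.
have two0 : (2%:R : C) ^+ k != 0 by rewrite expf_neq0 // pnatr_eq0.
have {EE} : a.[1] ^+ n * K.[1] ^+ k * a.[1] ^+ (m - k.*2) * a.[1] ^+ k = D.[1] ^+ n * a.[1] ^+ m.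
  apply: (mulfI two0); apply: (mulfI P1); transitivity (a.[1] ^+ n * P.[1] *
    (a.[1] ^+ (m - k.*2) * (K.[1] ^+ k * (2%:R ^+ k * a.[1] ^+ k)))); first by ring.
  by rewrite EE; ring.
rewrite -[in X in _ = _ * X](subnK km) exprD -addnn exprD => EE.
have {EE} : a.[1] ^+ n * K.[1] ^+ k = D.[1] ^+ n * a.[1] ^+ k.
  have h : a.[1] ^+ (m - (k + k)) * a.[1] ^+ k != 0 by rewrite mulf_neq0 ?expf_neq0.
  by apply: (mulIf h); rewrite !mulrA EE; ring.
rewrite /K -[1]/(1%:C) !toC_eval -!rmorphXn -!rmorphM /= => /complexI EE.
have pa1 : pa.[1] != 0 by rewrite gt_eqF // pa_gt0.
rewrite !exprVn; apply/eqP; rewrite eqr_div ?expf_neq0 // -EE; apply/eqP; ring.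
Qed.

End RationalSolution.

(** * The minimal polynomial of the Green function *)

Section MinimalPolynomial.
Import Order.TTheory GRing.Theory Num.Theory.
Local Open Scope complex_scope.
Local Open Scope ring_scope.
Set Implicit Arguments.
Unset Strict Implicit.
Unset Printing Implicit Defensive.

Variables (R : realType) (G : R -> R).
Local Notation C := R[i].

(** Only real arguments enter; the interval is infinite, so identities between polynomials in z can
    be tested on it. *)
Definition annihilates (P : {poly {poly C}}) :=
  forall z : R, -1 < z -> z < 1 -> P.[(G z)%:C, z%:C] = 0.

Lemma poly_eq0_unit (p : {poly C}) :
  (forall z : R, -1 < z -> z < 1 -> p.[z%:C] = 0) -> p = 0.
Proof.
move=> H; apply: (@poly_eq0_ext _ _ (fun n => ((n.+2)%:R^-1 : R)%:C)) => [i j|n].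
  move=> /complexI /invr_inj /eqP; rewrite eqr_nat => /eqP; by move=> [].
apply: H; first by apply: lt_trans (_ : 0 < _); rewrite ?invr_gt0 ?ltr0n // oppr_lt0.
by rewrite invf_lt1 ?ltr1n ?ltr0n.
Qed.

Lemma horner2_sum (P : {poly {poly C}}) n x y : (size P <= n.+1)%N ->
  P.[x, y] = \sum_(i < n.+1) (P`_i).[y] * x ^+ i.
Proof.
move=> sP; rewrite (horner_coef_wide _ sP) horner_sum; apply: eq_bigr => i _.
by rewrite hornerM horner_exp hornerC.
Qed.

Variable P0 : {poly {poly C}}.
Hypotheses (P0_neq0 : P0 != 0) (P0_ann : annihilates P0)
  (G_neq0 : forall z, -1 < z -> z < 1 -> G z != 0) (G_even : forall z, G (- z) = G z).

Lemma exists_minimal : exists P, [/\ P != 0, annihilates P &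
  forall Q, annihilates Q -> (size Q < size P)%N -> Q = 0].
Proof.
pose S k := `[< exists P, [/\ P != 0, annihilates P & size P = k] >].
have exS : exists k, S k by exists (size P0); apply/asboolP; exists P0.
case: (ex_minnP exS) => k /asboolP[P [Pn Pa sP]] H; exists P; split => // Q Qa sQ.
apply/eqP/negP => /negP Q0; have /H : S (size Q) by apply/asboolP; exists Q.
by rewrite -sP leqNgt sQ.
Qed.

(** By minimality every annihilator of degree at most n in the function value is proportional to P;
    this is stated by cross multiplication of coefficients, to stay with polynomials. The constant
    coefficient is nonzero since otherwise, G having no zeros, a factor could be divided out. *)
Lemma minimal_poly : exists (n : nat) (P : {poly {poly C}}),
  [/\ (0 < n)%N, size P = n.+1, annihilates P, P`_0 != 0 &
   forall Q, annihilates Q -> (size Q <= n.+1)%N -> forall i, P`_n * Q`_i = Q`_n * P`_i].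
Proof.
have [P [Pn Pa Pm]] := exists_minimal; exists (size P).-1, P.
have sP : size P = (size P).-1.+1 by rewrite prednK // lt0n size_poly_eq0.
set n := (size P).-1 in sP *; split => //.
- rewrite lt0n; apply/negP => /eqP n0; rewrite n0 in sP.
  have /size_poly1P[c c0 E] : size P == 1 by rewrite sP.
  move/negP: c0; apply; apply/eqP/poly_eq0_unit => z z1 z2.
  by have := Pa z z1 z2; rewrite E hornerC.
- apply/negP => /eqP P00.
  have /factor_theorem[Q E] : root P 0 by rewrite /root horner_coef0 P00.
  rewrite polyC0 subr0 in E.
  have Qn : Q != 0 by apply/negP => /eqP h; move: Pn; rewrite E h mul0r eqxx.
  suff Q0 : Q = 0 by rewrite Q0 eqxx in Qn.
  apply: Pm; last by rewrite E size_mulX.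
  move=> z z1 z2; have := Pa z z1 z2; rewrite E hornerM hornerX hornerM hornerC => /eqP.
  rewrite mulf_eq0 => /orP[/eqP //|]; rewrite -[0]/(0%:C) (inj_eq (@complexI R)).
  by rewrite (negPf (G_neq0 z1 z2)).
- move=> Q Qa sQ i; pose T := P`_n *: Q - Q`_n *: P.
  have : T = 0.
    apply: Pm.
      move=> z z1 z2; rewrite /T hornerD hornerN !hornerZ hornerD hornerN !hornerM.
      by rewrite Pa // Qa // !mulr0 subrr.
    rewrite [in X in (_ < X)%N]sP ltnS; apply/leq_sizeP => j nj.
    rewrite /T coefB !coefZ; move: nj; rewrite leq_eqVlt => /orP[/eqP <-|nj].
      by rewrite mulrC subrr.
    rewrite (nth_default _ (leq_trans sQ nj)) [P`_j]nth_default ?sP //.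
    by rewrite !mulr0 subrr.
  move/(congr1 (fun p : {poly {poly C}} => p`_i)); rewrite /T coefB !coefZ coef0.
  by move/eqP; rewrite subr_eq0 => /eqP.
Qed.

Variables (pa pb pD : {poly R}).
Local Notation toC := (map_poly (real_complex R)).
Local Notation a := (toC pa).
Local Notation b := (toC pb).
Local Notation D := (toC pD).
Hypothesis FE : forall z, -1 < z -> z < 1 ->
  [/\ pa.[z] != 0, -1 < pb.[z] / pa.[z], pb.[z] / pa.[z] < 1 &
   pa.[z] * G z = pD.[z] * G (pb.[z] / pa.[z])].
Hypotheses (pb0 : pb.[0] = 0) (pb_neq0 : pb != 0).

Lemma pa_neq0' : a != 0.
Proof.
rewrite map_poly_eq0; apply/negP => /eqP h.
by have [] := FE (z := 0); rewrite ?oppr_lt0 ?ltr01 // h horner0 eqxx.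
Qed.

Lemma minimal_sub_opp (p : {poly C}) x : (p \Po - 'X).[x] = p.[- x].
Proof. by rewrite horner_comp hornerN hornerX. Qed.

Lemma b_sub_neq0 s : b - s *: a != 0.
Proof.
have a00 : a.[0] != 0.
  rewrite -[0]/(0%:C) horner_map (inj_eq (@complexI R)).
  by have [] := FE (z := 0); rewrite ?oppr_lt0 ?ltr01.
have [->|s0] := eqVneq s 0; first by rewrite scale0r subr0 map_poly_eq0.
apply/negP => /eqP /(congr1 (horner^~ 0)); rewrite hornerD hornerN hornerZ horner0.
rewrite -{1}[0]/(0%:C) horner_map pb0 rmorph0 sub0r => /eqP.
by rewrite oppr_eq0 mulf_eq0 (negPf s0) (negPf a00).
Qed.

(* This is [P (b / a, Y * a / D)] with denominators cleared. *)
Lemma pullback_ann n m (P : {poly {poly C}}) : size P = n.+1 ->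
  (forall i, (i <= n)%N -> (size (P`_i)%R <= m.+1)%N) -> annihilates P ->
  annihilates (\poly_(i < n.+1) (hom a b m P`_i * a ^+ i * D ^+ (n - i))).
Proof.
move=> sP sm Pa z z1 z2; have [az d1 d2 E] := FE z1 z2.
have az' : a.[z%:C] != 0 by rewrite horner_map (inj_eq (@complexI R)).
have dE : b.[z%:C] / a.[z%:C] = (pb.[z] / pa.[z])%:C.
  by rewrite !horner_map rmorphM fmorphV.
rewrite (horner2_sum _ _ (size_poly _ _)).
have -> : \sum_(i < n.+1) ((\poly_(i0 < n.+1) (hom a b m P`_i0 * a ^+ i0 * D ^+ (n - i0)))`_(nat_of_ord i)).[z%:C] * (G z)%:C ^+ i
   = a.[z%:C] ^+ m * D.[z%:C] ^+ n * \sum_(i < n.+1) (P`_i).[b.[z%:C] / a.[z%:C]] * (G (pb.[z] / pa.[z]))%:C ^+ i.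
  rewrite mulr_sumr; apply: eq_bigr => i _; rewrite coef_poly ltn_ord.
  have im : (i <= n)%N by rewrite -ltnS.
  rewrite !hornerM !horner_exp hom_eval ?sm //.
  have -> : D.[z%:C] ^+ n = D.[z%:C] ^+ (n - i) * D.[z%:C] ^+ i by rewrite -exprD subnK.
  have -> : a.[z%:C] ^+ m * (P`_i).[b.[z%:C] / a.[z%:C]] * a.[z%:C] ^+ i * D.[z%:C] ^+ (n - i) * (G z)%:C ^+ i
    = a.[z%:C] ^+ m * (P`_i).[b.[z%:C] / a.[z%:C]] * D.[z%:C] ^+ (n - i) * (a.[z%:C] * (G z)%:C) ^+ i.
    rewrite exprMn; ring.
  rewrite !horner_map -rmorphM /= E rmorphM exprMn; ring.
by rewrite dE -horner2_sum ?sP // Pa // mulr0.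
Qed.

Lemma reflection_ann (P : {poly {poly C}}) : annihilates P ->
  annihilates (map_poly (comp_poly (- 'X)) P).
Proof.
move=> Pa z z1 z2.
rewrite (horner2_sum _ _ (leq_trans (size_poly _ _) (leqnSn _))).
transitivity (P.[(G (- z))%:C, (- z)%:C]); last by apply: Pa; lra.
rewrite (horner2_sum _ _ (leqnSn _)); apply: eq_bigr => i _.
by rewrite coef_map /= minimal_sub_opp G_even rmorphN.
Qed.

(** Uniqueness of the minimal polynomial is applied to its pullback along d and to its reflection;
    the relations between coefficients 0 and n are the equation and the evenness of A = P_0 / P_n.
    The gcd h of these two coefficients is then removed on both sides, together with hom h. *)
Lemma rational_solution : exists (n m : nat) (P Q : {poly C}),
  [/\ [/\ (0 < n)%N, coprimep P Q, Q != 0 & P != 0], (size P <= m.+1)%N, (size Q <= m.+1)%N,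
   a ^+ n * P * hom a b m Q = D ^+ n * Q * hom a b m P &
   P * (Q \Po - 'X) = (P \Po - 'X) * Q].
Proof.
have [n [P [n0 sP Pa P00 Pu]]] := minimal_poly.
have Pn0 : P`_n != 0.
  by have := lead_coef_eq0 P; rewrite lead_coefE sP /= => ->; rewrite -size_poly_eq0 sP.
pose m := (\max_(i < n.+1) size (P`_i)%R)%N.
have sm i : (i <= n)%N -> (size (P`_i)%R <= m.+1)%N.
  move=> hi; apply: leq_trans (leqnSn _).
  exact: (leq_bigmax (F := fun i : 'I_n.+1 => size (P`_i)) (Ordinal (hi : (i < n.+1)%N))).
have E1 := Pu _ (pullback_ann sP sm Pa) (size_poly _ _) 0%N.
have E2 := Pu _ (reflection_ann Pa) _ 0%N.
rewrite !coef_poly /= ltnSn subn0 subnn !expr0 !mulr1 in E1.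
have {}E2 : P`_n * (P`_0 \Po - 'X) = (P`_n \Po - 'X) * P`_0.
  by rewrite -!coef_map E2 // (leq_trans (size_poly _ _)) // sP.
set p0 := P`_0 in E1 E2 P00 *; set pn := P`_n in E1 E2 Pn0 *.
pose h := gcdp p0 pn; pose p := p0 %/ h; pose q := pn %/ h.
have p0E : p0 = h * p by rewrite mulrC divpK // dvdp_gcdl.
have pnE : pn = h * q by rewrite mulrC divpK // dvdp_gcdr.
have h0 : h != 0 by apply/negP => /eqP e; move: P00; rewrite p0E e mul0r eqxx.
have pp0 : p != 0 by apply/negP => /eqP e; move: P00; rewrite p0E e mulr0 eqxx.
have q0 : q != 0 by apply/negP => /eqP e; move: Pn0; rewrite pnE e mulr0 eqxx.
have sh : (0 < size h)%N by rewrite size_poly_gt0.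
pose m1 := (size h).-1; pose m2 := (m - m1)%N.
have sh1 : size h = m1.+1 by rewrite /m1 prednK.
have aux x y t : (x + y <= t.+1 -> 0 < y -> x <= t /\ y <= (t - x).+1)%N by clear; lia.
have sz (r : {poly C}) : r != 0 -> (size (h * r)%R <= m.+1)%N -> (m1 <= m)%N /\ (size r <= m2.+1)%N.
  move=> r0; rewrite size_mul // sh1 addSn /= => H.
  have : (0 < size r)%N by rewrite size_poly_gt0.
  by move: H; rewrite /m2; exact: aux.
have [m1m sp] := sz p pp0 (eq_ind _ (fun x : {poly C} => (size x <= m.+1)%N) (sm 0%N isT) _ p0E).
have [_ sq] := sz q q0 (eq_ind _ (fun x : {poly C} => (size x <= m.+1)%N) (sm n (leqnn n)) _ pnE).
have a0 := pa_neq0'.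
have hh : hom a b m1 h != 0 by apply: hom_neq0 => //; [exact: b_sub_neq0|rewrite sh1].
have hE (r : {poly C}) : (size r <= m2.+1)%N -> hom a b m (h * r) = hom a b m1 h * hom a b m2 r.
  by move=> sr; rewrite -homM ?sh1 // subnKC.
exists n, m2, p, q; split => //.
- by rewrite coprimep_div_gcd // P00.
- rewrite p0E pnE !hE // in E1.
  apply: (mulfI (mulf_neq0 h0 hh)); transitivity (hom a b m1 h * hom a b m2 q * a ^+ n * (h * p)); first by ring.
  by rewrite -E1; ring.
- rewrite p0E pnE !(rmorphM (comp_poly _)) /= in E2.
  have hn : h * (h \Po - 'X) != 0.
    rewrite mulf_neq0 //; apply/negP => /eqP e; move: h0.
    have : (h \Po - 'X) \Po - 'X = 0 by rewrite e comp_poly0.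
    by rewrite -comp_polyA (raddfN (comp_poly _)) /= comp_polyX opprK comp_polyXr => ->; rewrite eqxx.
  apply: (mulfI hn); transitivity ((h \Po - 'X) * (q \Po - 'X) * (h * p)); first by ring.
  by rewrite -E2; ring.
Qed.

End MinimalPolynomial.

(** * Networks with two terminals *)

Section Network.
Import Order.TTheory GRing.Theory Num.Theory.
Local Open Scope ring_scope.
Set Implicit Arguments.
Unset Strict Implicit.
Unset Printing Implicit Defensive.

Variables (R : realType) (N : nat) (adj : rel 'I_N.+1) (ia ic jc : 'I_N).
Local Notation l := (lift ord0).
Hypothesis adj_sym : symmetric adj.
Hypothesis adj_a : forall y, adj (l ia) y = (y == l ic).
Hypothesis adj_b : forall y, adj ord0 y = (y == l jc).
Hypothesis adj_conn : forall (S : pred 'I_N) i, S i ->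
  (forall j k, S j -> adj (l j) (l k) -> S k) -> forall k, S k.

(* [ord0] is the terminal [b] and [lift ord0 ia] the terminal [a]; in the notation of
   the header [npD / npa] is f, [npb / npa] is d and [npk / npa] is (1 - d) / (1 - z). *)
Definition ndeg (x : 'I_N.+1) : R := \sum_y (adj x y)%:R.
Definition nD (i : 'I_N) : R := ndeg (l i).
Definition nA (i j : 'I_N) : R := (adj (l i) (l j))%:R.
Let M := pencil_mx nD nA.
Definition npa : {poly R} := \det M.
Definition npD : {poly R} := \adj M ia ia.
Definition npb : {poly R} := 'X * \adj M jc ia.
Definition npk : {poly R} := \sum_i (nD i)%:P * \adj M i ia.

Local Notation pen := (pencil nD nA).

Lemma jc_neq_ia : (jc == ia) = false.
Proof.
apply/negP => /eqP E; have := adj_b (l ia); rewrite E eqxx adj_sym adj_a.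
by move/eqP; exact/eqP/neq_lift.
Qed.

Lemma nD_split i : nD i = (i == jc)%:R + \sum_j nA i j.
Proof.
rewrite /nD /ndeg big_ord_recl adj_sym adj_b (inj_eq lift_inj).
by congr (_ + _).
Qed.

Lemma nA_ge0 i j : 0 <= nA i j. Proof. exact: ler0n. Qed.
Lemma nA_sym i j : nA i j = nA j i. Proof. by rewrite /nA adj_sym. Qed.
Lemma nA_neq0 i j : (nA i j != 0) = adj (l i) (l j).
Proof. by rewrite pnatr_eq0 eqb0 negbK. Qed.

Lemma nA_conn (S : pred 'I_N) i : S i ->
  (forall j k, S j -> nA j k != 0 -> S k) -> forall k, S k.
Proof. by move=> Si H; apply: adj_conn Si _ => j k Sj jk; apply: (H j) => //; rewrite nA_neq0. Qed.

Lemma nA_ia j : nA ia j = (j == ic)%:R.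
Proof. by rewrite /nA adj_a (inj_eq lift_inj). Qed.

Lemma nD_ia : nD ia = 1.
Proof.
rewrite nD_split eq_sym jc_neq_ia add0r (bigD1 ic) //= nA_ia eqxx big1 ?addr0 // => j.
by rewrite nA_ia => /negPf ->.
Qed.

Lemma nD_gt0 i : 0 < nD i.
Proof.
have D0 j k : nA j k <= nD j.
  rewrite nD_split (bigD1 k) //= addrCA lerDl; apply: addr_ge0; first exact: ler0n.
  by apply: sumr_ge0 => m _; exact: nA_ge0.
rewrite lt_def sumr_ge0 ?andbT //; apply/negP => /eqP Di.
have Ai k : nA i k = 0.
  by apply/eqP; rewrite eq_le nA_ge0 andbT -Di D0.
have := @nA_conn (pred1 i) i (eqxx i) _ ia.
move=> H; have /eqP E : pred1 i ia.
  by apply: H => j k /eqP ->; rewrite Ai eqxx.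
by have := Ai ic; rewrite -E nA_ia eqxx => /eqP; rewrite oner_eq0.
Qed.

Lemma npencil_const z i : pen z (fun=> 1) i = (1 - z) * nD i + z * (i == jc)%:R.
Proof.
rewrite /pencil; under eq_bigr do rewrite mulr1.
have -> : \sum_j nA i j = nD i - (i == jc)%:R by rewrite nD_split addrAC subrr add0r.
ring.
Qed.

(** At z = 1 the form is the Dirichlet energy with b grounded: the squared value at [jc] is the
    energy of the edge to b. *)
Lemma npsd1 : psd nD nA 1.
Proof.
move=> u; have -> : pform nD nA 1 u u = u jc ^+ 2 +
    2^-1 * \sum_i \sum_j nA i j * (u i - u j) ^+ 2.
  rewrite pform_exp.
  have S1 : \sum_i \sum_j nA i j * (u i - u j) ^+ 2 =
      (\sum_i \sum_j nA i j * u i ^+ 2) *+ 2 - (\sum_i \sum_j nA i j * (u i * u j)) *+ 2.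
    rewrite [in RHS]mulr2n [X in _ + X - _]exchange_big /= -big_split /= -sumrMnl -sumrB.
    apply: eq_bigr => i _; rewrite -big_split -sumrMnl -sumrB /=.
    by apply: eq_bigr => j _; rewrite [nA j i]nA_sym; ring.
  rewrite S1; have -> : \sum_i nD i * (u i * u i) =
      u jc ^+ 2 + \sum_i \sum_j nA i j * u i ^+ 2.
    rewrite (eq_bigr (fun i => (i == jc)%:R * u i ^+ 2 + \sum_j nA i j * u i ^+ 2)).
      rewrite big_split /=; congr (_ + _).
      rewrite (bigD1 jc) //= eqxx mul1r big1 ?addr0 // => i /negPf ->.
      by rewrite mul0r.
    by move=> i _; rewrite nD_split mulrDl mulr_suml expr2.
  by field.
rewrite addr_ge0 ?sqr_ge0 // mulr_ge0 ?invr_ge0 // sumr_ge0 // => i _.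
by rewrite sumr_ge0 // => j _; rewrite mulr_ge0 ?sqr_ge0 // nA_ge0.
Qed.

(** A null vector would vanish nowhere by Perron-Frobenius, yet pairing it with the constant 1,
    whose image is concentrated at [jc], makes it vanish at [jc]. *)
Lemma npa1_neq0 : npa.[1] != 0.
Proof.
apply/negP => /eqP /pencil_ker[u un K].
have P1 := npsd1.
have u0 : pform nD nA 1 u u = 0 by rewrite /pform big1 // => i _; rewrite K mulr0.
have Hn := psd_ker_neq0 nA_ge0 nA_sym nA_conn ltr01 P1 u0 un.
have K1 := psd_ker nA_sym P1 u0.
have : pform nD nA 1 (fun=> 1) u = u jc.
  rewrite pformC; last exact: nA_sym.
  rewrite /pform (bigD1 jc) //= npencil_const eqxx subrr mul0r add0r !mulr1 big1 ?addr0 //.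
  by move=> i /negPf h; rewrite npencil_const h subrr mul0r mulr0 addr0 mulr0.
rewrite /pform big1; last by move=> i _; rewrite K1 mulr0.
by move/eqP; rewrite eq_sym; apply/negP.
Qed.

Lemma nsup : exists z0, [/\ 1 < z0, psd nD nA z0 & npa.[z0] = 0].
Proof.
apply: (psd_sup nD_gt0 nA_ge0 nA_sym npsd1 npa1_neq0).
exists (fun=> 1); rewrite (bigD1 ia) //= (bigD1 ic) //= nA_ia eqxx !mulr1.
rewrite -addrA ltr_pwDl // addr_ge0 //.
  by apply: sumr_ge0 => i _; rewrite !mulr1 nA_ge0.
by apply: sumr_ge0 => i _; apply: sumr_ge0 => j _; rewrite !mulr1 nA_ge0.
Qed.

(** The column of a in the adjugate is [npa] times the Green kernel with pole at a; it is polynomial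
    in z and still defined where the matrix is singular. *)
Definition npG z i := (\adj M i ia).[z].

Lemma npG_pencil z i : pen z (npG z) i = npa.[z] * (i == ia)%:R.
Proof.
have := pencil_mulmx nD nA z (col ia (\adj (map_mx (horner_eval z) M))) i.
have -> : map_mx (horner_eval z) M *m col ia (\adj (map_mx (horner_eval z) M)) =
    col ia (npa.[z])%:M.
  by rewrite !colE mulmxA mul_mx_adj /npa det_pencil.
rewrite [X in X = _ -> _]mxE [X in X = _ -> _]mxE mulr_natr => ->.
rewrite /pencil; congr (_ * _ - _ * _); [|apply: eq_bigr => j _; congr (_ * _)];
  by rewrite /npG adj_pencil [RHS]mxE.
Qed.

Lemma npencil_dot z (u v : 'I_N -> R) : \sum_i v i * pen z u i = \sum_i u i * pen z v i.
Proof. rewrite -/(pform nD nA z v u) pformC //; exact: nA_sym. Qed.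

Lemma sum_delta (F : 'I_N -> R) k : \sum_i F i * (i == k)%:R = F k.
Proof.
by rewrite (bigD1 k) //= eqxx mulr1 big1 ?addr0 // => i /negPf ->; rewrite mulr0.
Qed.

(** Green's identity for [npG z] and the constant function 1. *)
Lemma npa_sub_npb z : npa.[z] - npb.[z] = (1 - z) * npk.[z].
Proof.
have := npencil_dot z (npG z) (fun=> 1).
under eq_bigr do rewrite npG_pencil mul1r.
rewrite (sum_delta (fun=> _)) => ->.
rewrite (eq_bigr (fun i => (1 - z) * (nD i * npG z i) + z * npG z i * (i == jc)%:R)); last first.
  by move=> i _; rewrite npencil_const; ring.
rewrite big_split /= (sum_delta (fun i => z * npG z i)) /npb hornerM hornerX addrK.
rewrite -mulr_sumr /npk horner_sum; congr (_ * _); apply: eq_bigr => i _.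
by rewrite hornerM hornerC.
Qed.

Lemma npa0_gt0 : 0 < npa.[0].
Proof.
rewrite /npa det_pencil.
have -> : map_mx (horner_eval 0) M = diag_mx (\row_i nD i).
  by apply/matrixP => i j; rewrite pencil_mx_eval mul0r subr0 !mxE.
by rewrite det_diag prodr_gt0 // => i _; rewrite mxE nD_gt0.
Qed.

Lemma npG0_jc : npG 0 jc = 0.
Proof.
have := npG_pencil 0 jc; rewrite jc_neq_ia mulr0 /pencil mul0r subr0 => /eqP.
by rewrite mulf_eq0 gt_eqF ?nD_gt0 //= => /eqP.
Qed.

(** One factor X is explicit; the other comes from the matrix being diagonal at z = 0, with [jc]
    different from [ia] because a and b are not adjacent. *)
Lemma npb_X2 : exists q, npb = 'X^2 * q.
Proof.
have : root (\adj M jc ia) 0 by apply/eqP; exact: npG0_jc.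
by case/factor_theorem => q E; exists q; rewrite /npb E polyC0 subr0 expr2 mulrA mulrAC.
Qed.

(** Green's identity for [npG z] and a function u that solves the resolvent equation inside the
    cell. Divided by [npa], it is f (u(a) - z u(c)) = u(a) - d u(b), with c the neighbour of a: the
    local form of the functional equation. *)
Lemma nGreen z u : (forall i, i != ia -> pen z (fun j => u (l j)) i = z * (i == jc)%:R * u ord0) ->
  npD.[z] * (u (l ia) - z * u (l ic)) = npa.[z] * u (l ia) - npb.[z] * u ord0.
Proof.
move=> H; have := npencil_dot z (fun j => u (l j)) (npG z).
under [X in _ = X]eq_bigr do rewrite npG_pencil mulrA.
rewrite (sum_delta (fun i => u (l i) * npa.[z])) (bigD1 ia) //=.
have -> : pen z (fun j => u (l j)) ia = u (l ia) - z * u (l ic).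
  rewrite /pencil nD_ia mul1r; congr (_ - _ * _).
  under eq_bigr do rewrite nA_ia mulrC.
  by rewrite (sum_delta (fun j => u (l j))).
rewrite (eq_bigr (fun i => z * npG z i * u ord0 * (i == jc)%:R)); last first.
  by move=> i /H ->; ring.
have -> : \sum_(i < N | i != ia) z * npG z i * u ord0 * (i == jc)%:R =
    \sum_i z * npG z i * u ord0 * (i == jc)%:R.
  by rewrite [RHS](bigD1 ia) //= eq_sym jc_neq_ia mulr0 add0r.
rewrite (sum_delta (fun i => z * npG z i * u ord0)) => E.
have -> : npb.[z] = z * npG z jc by rewrite /npb hornerM hornerX.
by rewrite [npa.[z] * _]mulrC -E addrK.
Qed.

Lemma npb1 : npb.[1] = npa.[1].
Proof. by apply/esym/eqP; rewrite -subr_eq0 npa_sub_npb subrr mul0r. Qed.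

(** * Positivity up to the first singular point *)

Section Below.
Variables (z0 : R).
Hypotheses (z0_gt1 : 1 < z0) (psd_z0 : psd nD nA z0) (npa_z0 : npa.[z0] = 0).

Lemma npa_gt0 z : 0 <= z -> z < z0 -> 0 < npa.[z].
Proof.
move=> z_ge0 zz0; rewrite ltNge; apply/negP => h.
have [|y /andP[y0 yz]] := @poly_ivt R (- npa) 0 z z_ge0.
  by rewrite !hornerN oppr_le0 oppr_ge0 h ltW // npa0_gt0.
rewrite rootN; apply/negP; apply: (det_pencil_neq0 nD_gt0 y0 _ psd_z0).
exact: le_lt_trans zz0.
Qed.

Lemma npG_ge0 z i : 0 <= z -> z < z0 -> 0 <= npG z i.
Proof.
move=> z_ge0 zz0; apply: (pencil_ge0 nD_gt0 nA_ge0 z_ge0 zz0 psd_z0) => j.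
by rewrite npG_pencil mulr_ge0 // ltW // npa_gt0.
Qed.

(** Row a of the equation for [npG] reads npG(a) = npa + z npG(c), with c the neighbour of a. At z =
    1 this is r >= 1. *)
Lemma npD_ge_npa z : 0 <= z -> z < z0 -> npa.[z] <= npD.[z].
Proof.
move=> z_ge0 zz0; have := npG_pencil z ia; rewrite eqxx mulr1 /pencil nD_ia mul1r.
under eq_bigr do rewrite nA_ia mulrC.
rewrite (sum_delta (npG z)) => <-.
by rewrite gerBl mulr_ge0 // npG_ge0.
Qed.

(** The column of [jc]: z npU / npa solves the resolvent equation off b with value 1 at b, so its
    value at a is d. *)
Definition npU z i := (\adj M i jc).[z].

Lemma npU_pencil z i : pen z (fun i => npU z i) i = npa.[z] * (i == jc)%:R.
Proof.
have := pencil_mulmx nD nA z (col jc (\adj (map_mx (horner_eval z) M))) i.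
have -> : map_mx (horner_eval z) M *m col jc (\adj (map_mx (horner_eval z) M)) =
    col jc (npa.[z])%:M.
  by rewrite !colE mulmxA mul_mx_adj /npa det_pencil.
rewrite [X in X = _ -> _]mxE [X in X = _ -> _]mxE mulr_natr => ->.
rewrite /pencil; congr (_ * _ - _ * _); [|apply: eq_bigr => j _; congr (_ * _)];
  by rewrite /npU adj_pencil [RHS]mxE.
Qed.

Lemma npU_ia z : npU z ia = npG z jc.
Proof.
rewrite /npU /npG; congr (_.[z]).
have -> : \adj M ia jc = (\adj M)^T jc ia by rewrite [RHS]mxE.
by rewrite trmx_adj /M pencil_mx_sym //; exact: nA_sym.
Qed.

Lemma npb_npU z : npb.[z] = z * npU z ia.
Proof. by rewrite npU_ia /npb hornerM hornerX. Qed.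

(** Row a, whose only neighbour is [ic], supplies a second factor z; with it a comparison of z npU /
    npa with 1 at [ic] becomes one of d with z. *)
Lemma npb_npU_ic z : npb.[z] = z * (z * npU z ic).
Proof.
rewrite npb_npU; congr (_ * _); have := npU_pencil z ia.
rewrite eq_sym jc_neq_ia mulr0 /pencil nD_ia mul1r.
under eq_bigr do rewrite nA_ia mulrC.
by rewrite (sum_delta (npU z)) => /eqP; rewrite subr_eq0 => /eqP.
Qed.

Lemma npb_ge0 z : 0 <= z -> z < z0 -> 0 <= npb.[z].
Proof. by move=> h h'; rewrite npb_npU npU_ia mulr_ge0 // npG_ge0. Qed.

(** Up to the factor [npa], the defect 1 - z npU / npa has source (1 - z) Deg, whose sign changes at
    z = 1; the maximum principle then gives d < z below 1 and d > z above. *)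
Lemma npU_comp z i :
  pen z (fun i => npa.[z] + (- z) * npU z i) i = npa.[z] * (1 - z) * nD i.
Proof.
rewrite pencilD npU_pencil.
have -> : pen z (fun=> npa.[z]) i = npa.[z] * pen z (fun=> 1) i.
  rewrite /pencil -mulr_suml; under [in RHS]eq_bigr do rewrite mulr1.
  ring.
rewrite npencil_const; ring.
Qed.

Lemma npb_lt z : 0 < z -> z < 1 -> npb.[z] < z * npa.[z].
Proof.
move=> zp z1; have zz0 : z < z0 by apply: lt_trans z0_gt1.
have := pencil_gt0 nD_gt0 nA_ge0 (ltW zp) zz0 psd_z0 (v := fun i => npa.[z] + (- z) * npU z i).
move=> /(_ _ ic) H; rewrite npb_npU_ic ltr_pM2l // -subr_gt0 -mulNr; apply: H => i.
by rewrite npU_comp !mulr_gt0 ?npa_gt0 ?nD_gt0 ?subr_gt0 // ltW.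
Qed.

Lemma npb_gt z : 1 < z -> z < z0 -> z * npa.[z] < npb.[z].
Proof.
move=> z1 zz0; have zp : 0 < z by apply: lt_trans z1.
have := pencil_gt0 nD_gt0 nA_ge0 (ltW zp) zz0 psd_z0 (v := fun i => - npa.[z] + z * npU z i).
move=> /(_ _ ic) H; rewrite npb_npU_ic ltr_pM2l // -subr_gt0 addrC; apply: H => i.
have := npU_comp z i.
have -> : pen z (fun i => - npa.[z] + z * npU z i) i =
   - pen z (fun i => npa.[z] + (- z) * npU z i) i.
  rewrite !pencilD /pencil; under eq_bigr do rewrite mulrN.
  rewrite sumrN; ring.
move=> ->; have : 0 < npa.[z] * (z - 1) * nD i.
  by rewrite !mulr_gt0 ?npa_gt0 ?nD_gt0 ?subr_gt0 // ltW.
lra.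
Qed.

(** Otherwise a null vector of the matrix without row and column a, extended by 0, would be an
    isotropic vector at z0 vanishing at a, against Perron-Frobenius. *)
Lemma npD_z0 : npD.[z0] != 0.
Proof.
apply/negP => /eqP; rewrite /npD /M adj_pencil_diag => /pencil_ker[w [i0 wi0] Kw].
pose v i := if unlift ia i is Some j then w j else 0.
have vl j : v (lift ia j) = w j by rewrite /v liftK.
have va : v ia = 0 by rewrite /v unlift_none.
have z0p : 0 < z0 by apply: lt_trans z0_gt1.
have v0 : pform nD nA z0 v v = 0.
  rewrite /pform (bigD1_ord ia) //= va mul0r add0r big1 // => i _.
  have := Kw i; rewrite /pencil vl => E; rewrite -[RHS](mulr0 (w i)) -[in RHS]E.
  rewrite (bigD1_ord ia) //= va mulr0 add0r.
  by under eq_bigr do rewrite vl.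
have := psd_ker_neq0 nA_ge0 nA_sym nA_conn z0p psd_z0 v0 _ ia.
rewrite va eqxx => H; suff : false by []; apply: H.
by exists (lift ia i0); rewrite vl.
Qed.

(** The column [npG z0] is a null vector, nonzero at a by [npD_z0], hence nowhere zero. A negative
    sign would force a zero of [npb] in [1, z0), where it is at least z npa > 0. *)
Lemma npb_z0 : 0 < npb.[z0].
Proof.
have z0p : 0 < z0 by apply: lt_trans z0_gt1.
rewrite lt_def; apply/andP; split.
  rewrite /npb hornerM hornerX mulf_neq0 ?(gt_eqF z0p) //.
  apply: (psd_ker_neq0 nA_ge0 nA_sym nA_conn z0p psd_z0 (u := npG z0)).
    by rewrite /pform big1 // => i _; rewrite npG_pencil npa_z0 mul0r mulr0.
  by exists ia; exact: npD_z0.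
rewrite leNgt; apply/negP => h.
have [y /andP[y1 yz]] : exists2 y, 1 <= y <= z0 & root (- npb) y.
  apply: poly_ivt; first exact: ltW.
  by rewrite !hornerN oppr_le0 oppr_ge0 (ltW h) npb_ge0 ?ler01.
rewrite rootN /root => /eqP yb.
have yn : y < z0.
  by rewrite lt_neqAle yz andbT; apply/negP => /eqP E; move: h; rewrite -E yb ltxx.
have : 0 < npb.[y].
  have y0 : 0 <= y by apply: le_trans y1.
  move: y1; rewrite le_eqVlt => /orP[/eqP <-|y1]; first by rewrite npb1 npa_gt0.
  by apply: lt_trans (npb_gt y1 yn); rewrite mulr_gt0 ?npa_gt0 // (lt_trans ltr01).
by rewrite yb ltxx.
Qed.

(** d runs from 1 at z = 1 to infinity at z0, so it takes the value s at some z; and z < d(z) = s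
    there. *)
Lemma npreimage s : 1 < s -> exists z, [/\ 1 < z, z < z0, z < s & npb.[z] = s * npa.[z]].
Proof.
move=> s1; pose q := npb - s *: npa.
have q1 : q.[1] < 0.
  rewrite /q hornerD hornerN hornerZ.
  rewrite npb1.
  have := npa_gt0 ler01 z0_gt1; set a := npa.[1] => a0.
  by rewrite -{1}[a]mul1r -mulrBl pmulr_llt0 // subr_lt0.
have q0 : 0 < q.[z0] by rewrite /q hornerD hornerN hornerZ npa_z0 mulr0 subr0 npb_z0.
have [|z /andP[z1 zz0] rz] := @poly_ivt R q 1 z0 (ltW z0_gt1).
  by rewrite (ltW q1) ltW.
have {}z1 : 1 < z.
  by rewrite lt_neqAle z1 andbT; apply/negP => /eqP E; move: rz q1; rewrite -E /root => /eqP ->; rewrite ltxx.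
have {}zz0 : z < z0.
  by rewrite lt_neqAle zz0 andbT; apply/negP => /eqP E; move: rz q0; rewrite -E /root => /eqP ->; rewrite ltxx.
move: rz; rewrite /root /q hornerD hornerN hornerZ subr_eq0 => /eqP E.
exists z; split => //; have := npb_gt z1 zz0; rewrite E ltr_pM2r //.
by rewrite npa_gt0 // ltW // (lt_trans ltr01).
Qed.

End Below.

(** * Potential theory at z = 1 *)

Definition nlap (u : 'I_N.+1 -> R) x := ndeg x * u x - \sum_y (adj x y)%:R * u y.
(** The voltage when a current [npa.[1]] enters at a and b is grounded; its value at a is
    [npD.[1]]. *)
Definition npot x := if unlift ord0 x is Some i then npG 1 i else 0.

Lemma npot_l i : npot (l i) = npG 1 i. Proof. by rewrite /npot liftK. Qed.
Lemma npot0 : npot ord0 = 0. Proof. by rewrite /npot unlift_none. Qed.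

Lemma nlap_pencil u i : u ord0 = 0 -> nlap u (l i) = pen 1 (fun j => u (l j)) i.
Proof.
by move=> u0; rewrite /nlap big_ord_recl u0 mulr0 add0r /pencil mul1r.
Qed.

Lemma nlap_npot i : nlap npot (l i) = npa.[1] * (i == ia)%:R.
Proof.
rewrite nlap_pencil ?npot0 // -npG_pencil /pencil npot_l; congr (_ - _ * _).
by apply: eq_bigr => j _; rewrite npot_l.
Qed.

Lemma sum_lift (F : 'I_N.+1 -> R) : \sum_x F x = F ord0 + \sum_i F (l i).
Proof. by rewrite big_ord_recl. Qed.

(** Energy is voltage times current; the factor 2 counts each edge in both directions. *)
Lemma npot_energy :
  \sum_x \sum_y (adj x y)%:R * (npot x - npot y) ^+ 2 = (npD.[1] * npa.[1]) *+ 2.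
Proof.
have -> : npD.[1] * npa.[1] = \sum_x npot x * nlap npot x.
  rewrite sum_lift npot0 mul0r add0r.
  under [RHS]eq_bigr do rewrite nlap_npot mulrA.
  by rewrite (sum_delta (fun i => npot (l i) * _)) npot_l.
rewrite -sumrMnl.
have E : \sum_x \sum_y (adj x y)%:R * npot x ^+ 2 = \sum_x npot x * (ndeg x * npot x).
  by apply: eq_bigr => x _; rewrite -mulr_suml -/(ndeg x); ring.
rewrite (eq_bigr (fun x => \sum_y (adj x y)%:R * npot x ^+ 2 +
   \sum_y (adj y x)%:R * npot y ^+ 2 - (npot x * \sum_y (adj x y)%:R * npot y) *+ 2)).
  rewrite sumrB big_split /= [X in _ + X - _]exchange_big /= E -big_split -sumrB.
  by apply: eq_bigr => x _; rewrite /nlap /=; ring.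
move=> x _; rewrite mulr_sumr -big_split -sumrMnl -sumrB /=.
by apply: eq_bigr => y _; rewrite (adj_sym y x); ring.
Qed.

Section Swap.
Variable s : 'I_N.+1 -> 'I_N.+1.
Hypotheses (s_inj : injective s) (s_adj : forall x y, adj (s x) (s y) = adj x y)
  (s_b : s ord0 = l ia) (s_a : s (l ia) = ord0).

Lemma ndeg_swap x : ndeg (s x) = ndeg x.
Proof. by rewrite /ndeg (reindex_inj s_inj); apply: eq_bigr => y _; rewrite s_adj. Qed.

Lemma nlap_swap u x : nlap (fun y => u (s y)) x = nlap u (s x).
Proof.
rewrite /nlap ndeg_swap [in RHS](reindex_inj s_inj); congr (_ - _).
by apply: eq_bigr => y _; rewrite s_adj.
Qed.

(* The difference of the two sides is harmonic and vanishes at both terminals. *)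
Lemma npot_swap x : npot x + npot (s x) = npD.[1].
Proof.
pose S x := npot x + npot (s x) - npD.[1].
have S0 : S ord0 = 0 by rewrite /S npot0 s_b npot_l add0r subrr.
have Sa : S (l ia) = 0 by rewrite /S s_a npot0 npot_l addr0 subrr.
have LS i : i != ia -> nlap S (l i) = 0.
  move=> ni; have -> : nlap S (l i) = nlap npot (l i) + nlap npot (s (l i)).
    rewrite -nlap_swap /nlap /S.
    rewrite (eq_bigr (fun y => (adj (l i) y)%:R * npot y + (adj (l i) y)%:R * npot (s y)
       - npD.[1] * (adj (l i) y)%:R)); last by move=> y _; ring.
    rewrite sumrB big_split /= -mulr_sumr -/(ndeg (l i)); ring.
  rewrite nlap_npot (negPf ni) mulr0 add0r.
  case: (unliftP ord0 (s (l i))) => [k Ek|E0].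
    rewrite Ek nlap_npot; case: eqP => [kia|_]; last by rewrite mulr0.
    have := s_inj (etrans s_b (etrans (esym (congr1 l kia)) (esym Ek))).
    by move/eqP; rewrite (negPf (neq_lift _ _)).
  have := lift_inj (s_inj (etrans E0 (esym s_a))).
  by move/eqP; rewrite (negPf ni).
have [z0 [z01 pz0 _]] := nsup.
have Si i : S (l i) = 0.
  apply: (psd_lt_inj nD_gt0 ler01 z01 pz0 (u := fun i => S (l i))).
  rewrite /pform big1 // => j _; rewrite -nlap_pencil //.
  by have [->|/LS ->] := eqVneq j ia; rewrite ?Sa ?mul0r ?mulr0.
apply/eqP; rewrite -subr_eq0 -/(S x); apply/eqP.
by case: (unliftP ord0 x) => [k|] ->.
Qed.

(** By [npot_swap] the potential averages to npD(1) / 2 over x and s x. The result is d'(1) = mu r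
    in polynomial form. *)
Lemma npk1 : npk.[1] *+ 2 = npD.[1] * \sum_x ndeg x.
Proof.
have K : \sum_x ndeg x * npot x = npk.[1].
  rewrite sum_lift npot0 mulr0 add0r /npk horner_sum; apply: eq_bigr => i _.
  by rewrite npot_l hornerM hornerC.
rewrite mulr2n -{2}K (reindex_inj s_inj) -K -big_split mulr_sumr /=.
by apply: eq_bigr => x _; rewrite ndeg_swap -mulrDr npot_swap mulrC.
Qed.

End Swap.

Lemma nconnect : exists p, [/\ path adj (l ia) p, last (l ia) p = ord0 & uniq (l ia :: p)].
Proof.
have C k : connect adj (l ia) (l k).
  apply: (adj_conn (S := fun k => connect adj (l ia) (l k)) (i := ia)).
    exact: connect0.
  by move=> i j /connect_trans h /connect1; apply: h.
have /connectP[p pp E] : connect adj (l ia) ord0.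
  apply: connect_trans (C jc) (connect1 _).
  by rewrite adj_sym adj_b.
by move: E; case/shortenP: pp => p' pp' u' _ E; exists p'.
Qed.

Lemma ndeg_ge1 x : exists y, adj x y.
Proof.
case: (unliftP ord0 x) => [k ->|->]; last by exists (l jc); rewrite adj_b.
apply: contrapT => h; have := nD_gt0 k; rewrite /nD /ndeg big1 ?ltxx // => y _.
by case: (boolP (adj (l k) y)) => // ky; case: h; exists y.
Qed.

(* Thomson's principle along a simple path from [a] to [b] bounds the effective
   resistance by its length, hence by the number of edges. *)
Lemma npath : npa.[1] * \sum_x ndeg x <= npD.[1] *+ 2 ->
  exists t, [/\ uniq t, forall x, x \in t &
    forall x y, adj x y = ((index x t).+1 == index y t) || ((index y t).+1 == index x t)].
Proof.
move=> H; have [p [pp lp up]] := nconnect; set t := l ia :: p in up.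
have [z0 [z01 pz0 _]] := nsup.
have a0 : 0 < npa.[1] := npa_gt0 pz0 ler01 z01.
have D0 : 0 < npD.[1] := lt_le_trans a0 (npD_ge_npa pz0 ler01 z01).
pose tn i := nth ord0 t i; pose n := size p.
have tn_inj i j : (i <= n)%N -> (j <= n)%N -> tn i = tn j -> i = j.
  by move=> hi hj /eqP; rewrite nth_uniq // => /eqP.
have tadj i : (i < n)%N -> adj (tn i) (tn i.+1) by move=> hi; have /pathP := pp; apply.
pose F1 := [set (tn i, tn i.+1) | i : 'I_n].
pose F2 := [set (tn i.+1, tn i) | i : 'I_n].
pose E := [set xy : 'I_N.+1 * 'I_N.+1 | adj xy.1 xy.2].
have inj1 : injective (fun i : 'I_n => (tn i, tn i.+1)).
  by move=> i j [/tn_inj h _]; apply/val_inj/h; exact: ltnW.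
have inj2 : injective (fun i : 'I_n => (tn i.+1, tn i)).
  by move=> i j [_ /tn_inj h]; apply/val_inj/h; exact: ltnW.
have dis : [disjoint F1 & F2].
  rewrite -setI_eq0; apply/eqP/setP => -[x y]; rewrite !inE; apply/negP.
  case/andP => /imsetP[i _ [-> ->]] /imsetP[j _ [/tn_inj e1 /tn_inj e2]].
  have := e1 (ltnW (ltn_ord i)) (ltn_ord j); have := e2 (ltn_ord i) (ltnW (ltn_ord j)).
  by move=> <- /eqP; rewrite -addn2 -[X in X == _]addn0 eqn_add2l.
have subE : F1 :|: F2 \subset E.
  apply/fintype.subsetP => -[x y]; rewrite !inE /= => /orP[]/imsetP[i _ [-> ->]]; first exact: tadj.
  by rewrite adj_sym tadj.
have cardF : #|F1 :|: F2| = (n + n)%N.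
  by rewrite cardsU disjoint_setI0 // cards0 subn0 !card_imset // card_ord.
have cardE : (#|E|%:R : R) = \sum_x ndeg x.
  rewrite -sum1dep_card natr_sum big_mkcond /= -(pair_bigA _ (fun x y => if adj x y then 1 else 0)) /=.
  by apply: eq_bigr => x _; apply: eq_bigr => y _; case: (adj x y).
have tel : \sum_(i < n) (npot (tn i) - npot (tn i.+1)) = npD.[1].
  have := telescope_sumr (fun i => - npot (tn i)) (leq0n n).
  rewrite big_mkord => h; rewrite (eq_bigr (fun i : 'I_n => - npot (tn i.+1) - - npot (tn i))).
    rewrite h /tn {1}/n -[size p]/(size t).-1 nth_last /= lp npot0 oppr0 npot_l add0r opprK.
    by [].
  by move=> i _; ring.
have n0 : (0 < n)%N.
  by rewrite lt0n; apply/negP => /eqP /size0nil p0; move: lp; rewrite p0 => /eqP; rewrite eq_sym (negPf (neq_lift _ _)).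
(* The mean drop along the path; 0 <= (drop - c)^2, summed, is the Cauchy-Schwarz bound for the
   energy on the path. *)
pose c := npD.[1] / n%:R.
have nR : (n%:R : R) != 0 by rewrite pnatr_eq0 -lt0n.
pose w (xy : 'I_N.+1 * 'I_N.+1) : R := (npot xy.1 - npot xy.2) ^+ 2.
have low : (npD.[1] ^+ 2 / n%:R) *+ 2 <= \sum_(xy in F1 :|: F2) w xy.
  rewrite (eq_bigl [predU F1 & F2]) => [|xy]; last by rewrite !inE.
  rewrite bigU //=.
  rewrite /F1 /F2 !big_imset /=; try by move=> i j _ _; (exact: inj1 || exact: inj2).
  rewrite -big_split /=.
  have -> : (npD.[1] ^+ 2 / n%:R) *+ 2 =
     \sum_(i < n) (c * (npot (tn i) - npot (tn i.+1)) *+ 4 - c ^+ 2 *+ 2).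
    rewrite sumrB sumrMnl -mulr_sumr tel sumr_const card_ord /c; field.
    exact: nR.
  apply: ler_sum => i _; rewrite /w /=.
  have := sqr_ge0 (npot (tn i) - npot (tn i.+1) - c); nra.
have up2 : \sum_(xy in F1 :|: F2) w xy <= (npD.[1] * npa.[1]) *+ 2.
  rewrite -npot_energy pair_bigA /=.
  rewrite [X in _ <= X](eq_bigr (fun xy => if xy \in E then w xy else 0)).
    rewrite -big_mkcond /= [X in _ <= X](big_setID (F1 :|: F2)) /=.
    rewrite (finset.setIidPr subE) lerDl sumr_ge0 // => xy _; exact: sqr_ge0.
  by move=> [x y] _; rewrite inE /=; case: (adj x y); rewrite ?mul1r ?mul0r.
(* The two energy bounds give npD <= n npa at 1; with [H] the number of oriented edges is at most 2
   n, the number of those on the path. *)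
have EF : F1 :|: F2 = E.
  apply/eqP; rewrite eqEcard subE cardF -(ler_nat R) cardE natrD /=.
  have := le_trans low up2; rewrite lerMn2r /= ler_pdivrMr ?ltr0n // expr2 -mulrA ler_pM2l //.
  move=> h; rewrite -(ler_pM2l a0); apply: le_trans H _; lra.
have adjt x y : adj x y -> exists i : 'I_n, (x = tn i /\ y = tn i.+1) \/ (x = tn i.+1 /\ y = tn i).
  move=> xy; have : (x, y) \in E by rewrite inE.
  by rewrite -EF inE => /orP[] /imsetP[i _ [-> ->]]; exists i; [left|right].
have idx i : (i <= n)%N -> index (tn i) t = i by move=> h; rewrite /tn index_uniq.
have all_t x : x \in t.
  have [y /adjt[i [[-> _]|[-> _]]]] := ndeg_ge1 x; apply: mem_nth; rewrite ltnS.
    exact: ltnW.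
  exact: ltn_ord.
exists t; split => // x y; apply/idP/idP.
  move/adjt => [i [[-> ->]|[-> ->]]]; rewrite !idx ?eqxx ?orbT //; exact: ltnW.
have lt_t u : (index u t < n.+1)%N by rewrite -[n.+1]/(size t) index_mem.
have tE u : tn (index u t) = u by rewrite /tn nth_index.
case/orP => /eqP e.
  by rewrite -(tE x) -(tE y) -e tadj // -ltnS e.
by rewrite adj_sym -(tE x) -(tE y) -e tadj // -ltnS e.
Qed.

(** * Bipartite networks and parity in z *)

Section Bipartite.
Variable col : 'I_N.+1 -> bool.
Hypothesis col_adj : forall x y, adj x y -> col x != col y.

Let sg i : R := (-1) ^+ col (l i).

Lemma sg_sq i : sg i * sg i = 1. Proof. exact: sqrr_sign. Qed.

Lemma sg_nA i j : nA i j * sg j = - sg i * nA i j.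
Proof.
rewrite /nA; case: (boolP (adj (l i) (l j))) => [/col_adj|]; last by rewrite mul0r mulr0.
by rewrite /sg mul1r mulr1; case: (col (l i)); case: (col (l j)); rewrite // ?expr0 ?expr1 ?opprK.
Qed.

(** Conjugation by the diagonal matrix of colour signs exchanges the matrices at z and -z. *)
Lemma npa_opp z : npa.[- z] = npa.[z].
Proof.
rewrite /npa !det_pencil; pose S : 'M[R]_N := diag_mx (\row_i sg i).
have SS : S *m S = 1%:M.
  by apply/matrixP => i j; rewrite mul_diag_mx !mxE mulrnAr sg_sq.
have -> : map_mx (horner_eval (- z)) M = S *m map_mx (horner_eval z) M *m S.
  apply/matrixP => i j; rewrite mul_mx_diag mul_diag_mx [RHS]mxE [X in _ = X * _]mxE.
  rewrite [in RHS]mxE [X in _ = _ * X]mxE !pencil_mx_eval mulrBr mulrBl.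
  rewrite -[sg i * (z * _) * _]mulrA -[z * _ * _]mulrA sg_nA.
  have -> : sg i * (z * (- sg i * nA i j)) = - (sg i * sg i) * z * nA i j by ring.
  rewrite sg_sq; case: eqP => [->|_]; last by rewrite !mulr0n; ring.
  by rewrite !mulr1n [sg j * _]mulrC -[_ * sg j * sg j]mulrA sg_sq; ring.
rewrite !det_mulmx mulrAC -det_mulmx SS det1 mul1r //.
Qed.

(** Twisting the column at z by the colour signs gives a solution of the equation at -z; uniqueness,
    from definiteness at z, identifies the two. *)
Lemma npG_opp z i : 0 <= z -> z < 1 -> npG (- z) i = sg ia * sg i * npG z i.
Proof.
move=> z_ge0 z1; pose v j := npG (- z) j + (- 1) * (sg ia * sg j * npG z j).
have Ev j : pen (- z) (fun j => sg ia * sg j * npG z j) j = npa.[- z] * (j == ia)%:R.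
  have -> : pen (- z) (fun j => sg ia * sg j * npG z j) j = sg ia * sg j * pen z (npG z) j.
    rewrite /pencil (eq_bigr (fun k => - (sg ia * sg j) * (nA j k * npG z k))).
      rewrite -mulr_sumr; ring.
    move=> k _; transitivity (sg ia * (nA j k * sg k) * npG z k); first by ring.
    by rewrite sg_nA; ring.
  rewrite npG_pencil npa_opp; case: eqP => [->|_]; last by rewrite !mulr0.
  by rewrite sg_sq mul1r.
have Pv j : pen (- z) v j = 0.
  by rewrite /v pencilD Ev npG_pencil mulN1r subrr.
pose w j := sg j * v j.
have Pw j : pen z w j = 0.
  have -> : pen z w j = sg j * pen (- z) v j; last by rewrite Pv mulr0.
  rewrite /pencil /w (eq_bigr (fun k => - sg j * (nA j k * v k))).
    by rewrite -mulr_sumr; ring.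
  by move=> k _; rewrite mulrA sg_nA mulrA.
have [z0 [z01 pz0 _]] := nsup.
have w0 j : w j = 0.
  apply: (psd_lt_inj nD_gt0 z_ge0 _ pz0); first exact: lt_trans z01.
  by rewrite /pform big1 // => k _; rewrite Pw mulr0.
have : v i = 0.
  by have := w0 i; rewrite /w => /(congr1 (fun x => sg i * x)); rewrite mulrA sg_sq mul1r mulr0.
by rewrite /v mulN1r => /eqP; rewrite subr_eq0 => /eqP.
Qed.

Lemma npD_opp z : 0 <= z -> z < 1 -> npD.[- z] = npD.[z].
Proof. by move=> h1 h2; rewrite -![npD.[_]]/(npG _ ia) npG_opp // sg_sq mul1r. Qed.

(** The sign depends on whether [jc] and [ia] have the same colour; either case serves, because G is
    even. *)
Lemma npb_opp z : 0 <= z -> z < 1 -> npb.[- z] = npb.[z] \/ npb.[- z] = - npb.[z].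
Proof.
move=> h1 h2; rewrite /npb !hornerM !hornerX -![(\adj M jc ia).[_]]/(npG _ jc) npG_opp //.
by rewrite /sg; case: (col _); case: (col _); rewrite ?expr0 ?expr1; [right|left|left|right]; ring.
Qed.

(** * The lower bound on the effective resistance *)

Section Main.
Variable s : 'I_N.+1 -> 'I_N.+1.
Hypotheses (s_inj : injective s) (s_adj : forall x y, adj (s x) (s y) = adj x y)
  (s_b : s ord0 = l ia) (s_a : s (l ia) = ord0).
Variables (G : R -> R) (P0 : {poly {poly R[i]%C}}).
Hypotheses (P0_neq0 : P0 != 0) (P0_ann : annihilates G P0)
  (G_neq0 : forall z, -1 < z -> z < 1 -> G z != 0) (G_even : forall z, G (- z) = G z)
  (FE : forall z, 0 < z -> z < 1 -> npa.[z] * G z = npD.[z] * G (npb.[z] / npa.[z])).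

Lemma ndistance_bound z : 0 < z -> z < 1 -> 0 <= npb.[z] / npa.[z] /\ npb.[z] / npa.[z] < 1.
Proof.
move=> zp z1; have [z0 [z01 pz0 _]] := nsup; have zz := lt_trans z1 z01.
have a0 := npa_gt0 pz0 (ltW zp) zz; split.
  by rewrite divr_ge0 ?(ltW a0) // (npb_ge0 pz0) // ltW.
rewrite ltr_pdivrMr // mul1r; apply: lt_trans (npb_lt z01 pz0 zp z1) _.
by rewrite gtr_pMl.
Qed.

Lemma FE_full z : -1 < z -> z < 1 ->
  [/\ npa.[z] != 0, -1 < npb.[z] / npa.[z], npb.[z] / npa.[z] < 1 &
   npa.[z] * G z = npD.[z] * G (npb.[z] / npa.[z])].
Proof.
have pos y : 0 < y -> y < 1 -> [/\ npa.[y] != 0, -1 < npb.[y] / npa.[y], npb.[y] / npa.[y] < 1 &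
   npa.[y] * G y = npD.[y] * G (npb.[y] / npa.[y])].
  move=> y0 y1; have [d0 d1] := ndistance_bound y0 y1; split => //; last exact: FE.
    have [z0 [z01 pz0 _]] := nsup.
    by rewrite gt_eqF // (npa_gt0 pz0) ?ltW // (lt_trans y1 z01).
  by apply: lt_le_trans d0; rewrite oppr_lt0.
move=> z1 z2; case: (ltgtP z 0) => [zn|zp|->]; last first.
- have -> : npb.[0] = 0 by rewrite /npb hornerM hornerX mul0r.
  rewrite mul0r oppr_lt0 ltr01 gt_eqF ?npa0_gt0 //; split => //; congr (_ * _).
  have := npG_pencil 0 ia; rewrite eqxx mulr1 /pencil mul0r subr0 nD_ia mul1r => <-.
  by [].
- exact: pos.
have y0 : 0 < - z by rewrite oppr_gt0.
have y1 : - z < 1 by rewrite ltrNl.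
have [e1 e2 e3 e4] := pos _ y0 y1.
have := npb_opp (ltW y0) y1; have := npD_opp (ltW y0) y1; have := npa_opp z.
rewrite opprK => ea eD eb; rewrite -ea eD -(G_even z).
case: eb => ->; first by split.
by rewrite mulNr (G_even (_ / _)) ltrN2 ltrNl; split.
Qed.

Lemma npk_eq : npa - npb = (1 - 'X) * npk.
Proof.
apply: (poly_eq_ext (oner_neq0 _)) => x _.
by rewrite hornerM !hornerD !hornerN hornerX hornerC npa_sub_npb.
Qed.

Lemma npD_real x : root (map_poly (real_complex R) npD) x -> x \is Num.real.
Proof.
rewrite /npD /M adj_pencil_diag; apply: pencil_real_root => [i|i j]; first exact: nD_gt0.
exact: nA_sym.
Qed.

(** This is mu <= r with denominators cleared: half the sum of the degrees is the number mu of
    edges. *)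
Lemma resistance_ge : npa.[1] * \sum_x ndeg x <= npD.[1] *+ 2.
Proof.
have [z0 [z01 pz0 az0]] := nsup.
have agt := npa_gt0 pz0.
have Dgt z : 0 <= z -> z < z0 -> 0 < npD.[z].
  by move=> h h'; apply: lt_le_trans (npD_ge_npa pz0 h h'); exact: agt.
have bz0 := npb_z0 z01 pz0 az0.
have bn0 : npb != 0 by apply/negP => /eqP h; move: bz0; rewrite h horner0 ltxx.
have b0 : npb.[0] = 0 by rewrite /npb hornerM hornerX mul0r.
have [n [m [P [Q [[n0 cop Q0 PP0] sP sQ feq ev]]]]] :=
  rational_solution P0_neq0 P0_ann G_neq0 G_even FE_full b0 bn0.
have [k [nk E]] := exponent_relation (lt0r_neq0 npa0_gt0) npb_X2 npk_eq z01 az0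
  (lt0r_neq0 bz0) (npD_z0 z01 pz0) agt Dgt (npb_ge0 pz0)
  (npb_lt z01 pz0) (npreimage z01 pz0 az0) npD_real n0 cop Q0 PP0 sP sQ feq ev.
have a1 : 0 < npa.[1] := agt 1 ler01 z01.
set r := npD.[1] / npa.[1] in E.
have r1 : 1 <= r by rewrite ler_pdivlMr // mul1r (npD_ge_npa pz0 ler01 z01).
set mu := (\sum_x ndeg x) / 2.
have kE : npk.[1] / npa.[1] = mu * r.
  have := npk1 s_inj s_adj s_b s_a; rewrite /mu /r => h.
  have -> : npk.[1] = npD.[1] * (\sum_x ndeg x) / 2 by rewrite -h; field.
  by ring.
have k0 : (0 < k)%N by have := leq_trans n0 nk; rewrite double_gt0.
suff : mu <= r.
  rewrite /mu /r ler_pdivlMr // => h.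
  have -> : npa.[1] * \sum_x ndeg x = ((\sum_x ndeg x) / 2 * npa.[1]) *+ 2 by field.
  by rewrite lerMn2r h.
rewrite leNgt; apply/negP => h.
have r0 : 0 < r by apply: lt_le_trans r1.
have : r ^+ n < (mu * r) ^+ k.
  (* Here r >= 1 allows n to be replaced by 2 k. *)
  apply: le_lt_trans (_ : (r * r) ^+ k < _).
    by rewrite -expr2 -exprM mulnC muln2 ler_weXn2l.
  have mu0 : 0 <= mu := ltW (lt_trans r0 h).
  have rr : r * r < mu * r by rewrite (ltr_pM2r r0).
  by rewrite (ltr_pXn2r k0) // nnegrE mulr_ge0 // ltW.
by rewrite -kE E ltxx.
Qed.

Theorem network_path : exists t, [/\ uniq t, forall x, x \in t &
    forall x y, adj x y = ((index x t).+1 == index y t) || ((index y t).+1 == index x t)].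
Proof. exact: npath resistance_ge. Qed.

End Main.
End Bipartite.

End Network.

(** * Green functions of locally finite graphs *)

Section GreenReal.
Import Order.TTheory GRing.Theory Num.Theory numFieldNormedType.Exports.
Local Open Scope classical_set_scope.
Local Open Scope ring_scope.
Set Implicit Arguments.
Unset Strict Implicit.
Unset Printing Implicit Defensive.

(** Order and norm are preserved by f, and [fe] makes the images of positive reals arbitrarily small
    in K; so convergence is carried over together with the sum. *)
Lemma power_series_rmorph (R : realType) (K : numFieldType) (f : {rmorphism R -> K})
    (a : nat -> R) (z l : R) :
  {mono f : x y / x < y} -> (forall x, `|f x| = f `|x|) ->
  (forall e : K, 0 < e -> exists2 e', 0 < e' & f e' <= e) ->
  (fun n => series (fun n => a n * z ^+ n) n) @ \oo --> l ->
  power_series_sum (fun n => f (a n)) (f z) = f l.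
Proof.
move=> fm fn fe cl; rewrite /power_series_sum; apply: cvg_lim => //.
have -> : series (fun n => f (a n) * f z ^+ n) = f \o series (fun n => a n * z ^+ n).
  apply/funext => n /=; rewrite /series /= rmorph_sum; apply: eq_bigr => i _.
  by rewrite rmorphM rmorphXn.
apply/cvgrPdist_lt => e e0; have [e' e'0 ee] := fe e e0.
move/cvgrPdist_lt/(_ _ e'0): cl; apply: filterS => n /= h.
by rewrite -rmorphB fn; apply: lt_le_trans ee; rewrite fm.
Qed.

Variables (R : realType) (T : choiceType) (X : graph T).
Hypothesis lf : locally_finite X.

Lemma nbrs_finite x : finite_set (nbrs X x).
Proof.
have [/lf //|nx] := pselect (vset X x).
suff -> : nbrs X x = set0 by exact: finite_set0.
by apply/seteqP; split => // y /edge_vset.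
Qed.

Definition nbr_seq x : seq T := fset_set (nbrs X x).

Lemma mem_nbr_seq x y : (y \in nbr_seq x) = edge X x y.
Proof.
by rewrite /nbr_seq in_fset_set; [apply/idP/idP => [/set_mem|/mem_set]|exact: nbrs_finite].
Qed.

Lemma nbr_seq_uniq x : uniq (nbr_seq x). Proof. exact: fset_uniq. Qed.

Lemma size_nbr_seq x : size (nbr_seq x) = degree X x. Proof. by []. Qed.

Lemma sum_nbrs (F : T -> R) x : \sum_(w \in nbrs X x) F w = \sum_(w <- nbr_seq x) F w.
Proof. by rewrite fsbig_finite; last exact: nbrs_finite. Qed.

Lemma perm_nbr_seq x s : uniq s -> (forall y, (y \in s) = edge X x y) ->
  perm_eq (nbr_seq x) s.
Proof.
move=> us H; apply: uniq_perm => //; first exact: nbr_seq_uniq.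
by move=> y; rewrite mem_nbr_seq H.
Qed.

Local Notation deg x := ((degree X x)%:R : R).

Definition mean (F : T -> R) x := (deg x)^-1 * \sum_(w <- nbr_seq x) F w.

Lemma srw_probS n x y : srw_prob R X n.+1 x y = mean (fun w => srw_prob R X n w y) x.
Proof.
rewrite /= /mean mulr_sumr -(sum_nbrs (fun w => (deg x)^-1 * srw_prob R X n w y)).
by [].
Qed.

Lemma mean_le (F : T -> R) x K : 0 <= K -> (forall w, edge X x w -> `|F w| <= K) ->
  `|mean F x| <= K.
Proof.
move=> K0 H; rewrite /mean normrM normfV normr_nat.
have [d0|dn] := eqVneq (degree X x) 0%N; first by rewrite d0 invr0 mul0r.
rewrite mulrC ler_pdivrMr ?ltr0n ?lt0n //.
apply: le_trans (ler_norm_sum _ _ _) _.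
rewrite -size_nbr_seq mulr_natr.
have -> : K *+ size (nbr_seq x) = \sum_(w <- nbr_seq x) K.
  by rewrite big_const_seq count_predT iter_addr_0.
rewrite big_seq [X in _ <= X]big_seq; apply: ler_sum => w; rewrite mem_nbr_seq; exact: H.
Qed.

Lemma srw_prob_ge0 n x y : 0 <= srw_prob R X n x y.
Proof.
elim: n x => [|n IH] x; first by rewrite /= ler0n.
by rewrite srw_probS /mean mulr_ge0 ?invr_ge0 ?ler0n // sumr_ge0.
Qed.

Lemma srw_prob_le1 n x y : `|srw_prob R X n x y| <= 1.
Proof.
elim: n x => [|n IH] x; first by rewrite /= normr_nat lern1 leq_b1.
by rewrite srw_probS mean_le.
Qed.

Variable o : T.

(** The target o is fixed and the starting point varies, so that conditioning on the first step
    gives a closed system of equations. *)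
Definition gf_term (x : T) (z : R) n := srw_prob R X n x o * z ^+ n.
Definition gf (x : T) (z : R) : R := limn (series (gf_term x z)).

Lemma gf_cvg x z : `|z| < 1 -> cvgn (series (gf_term x z)).
Proof.
move=> z1; apply: normed_cvg.
apply: (@series_le_cvg _ _ (geometric 1 `|z|)) => [n|n|n|].
- exact: normr_ge0.
- by rewrite /geometric /= mul1r exprn_ge0.
- by rewrite /gf_term /geometric /= normrM normrX ler_wpM2r ?exprn_ge0 // srw_prob_le1.
- by apply: is_cvg_geometric_series; rewrite normr_id.
Qed.

Lemma gf_bound x z : 0 <= z -> z < 1 -> `|gf x z| <= (1 - z)^-1.
Proof.
move=> z0 z1; have zn : `|z| < 1 by rewrite ger0_norm.
have cg : cvgn (series (geometric 1 z)) by exact: is_cvg_geometric_series.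
have le n : gf_term x z n <= geometric 1 z n.
  rewrite /gf_term /geometric /=; apply: ler_wpM2r; first exact: exprn_ge0.
  by apply: le_trans (ler_norm _) _; exact: srw_prob_le1.
rewrite ger0_norm; last first.
  apply: limr_ge; first exact: gf_cvg.
  by near=> n; rewrite /series /= sumr_ge0 // => i _; rewrite mulr_ge0 ?srw_prob_ge0 ?exprn_ge0.
apply: (le_trans (lim_series_le (@gf_cvg x z zn) cg le)).
by rewrite (cvg_lim _ (@cvg_geometric_series _ 1 z zn)) // mul1r.
Unshelve. all: by end_near.
Qed.

Lemma cvg_sum_seq (s : seq T) (u : T -> nat -> R) (l : T -> R) :
  (forall x, u x @ \oo --> l x) ->
  (fun n => \sum_(x <- s) u x n) @ \oo --> \sum_(x <- s) l x.
Proof.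
move=> H; elim: s => [|x s IH].
  by rewrite big_nil; under eq_fun do rewrite big_nil; exact: cvg_cst.
by rewrite big_cons; under eq_fun do rewrite big_cons; exact: cvgD.
Qed.

Lemma gf_resolvent x z : `|z| < 1 -> gf x z = (x == o)%:R + z * mean (fun w => gf w z) x.
Proof.
move=> z1; apply: cvg_lim => //.
rewrite -cvg_shiftS.
have -> : (fun n => series (gf_term x z) n.+1) =
   (fun n => (x == o)%:R + z * ((deg x)^-1 * \sum_(w <- nbr_seq x) series (gf_term w z) n)).
  apply/funext => n; rewrite /series /= big_nat_recl //= /gf_term expr0 mulr1; congr (_ + _).
  rewrite exchange_big /= !mulr_sumr; apply: eq_bigr => i _.
  by rewrite -/(srw_prob R X i.+1 x o) srw_probS /mean exprS -!mulr_suml; ring.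
apply: cvgD; first exact: cvg_cst.
apply: cvgMr; apply: cvgMr; apply: cvg_sum_seq => w; exact: gf_cvg.
Qed.

Lemma gf_ge1 z : 0 <= z -> z < 1 -> 1 <= gf o z.
Proof.
move=> z0 z1; apply: limr_ge; first by apply: gf_cvg; rewrite ger0_norm.
near=> n; rewrite /series /=.
have n0 : (0 < n)%N by near: n; exact: nbhs_infty_gt.
rewrite -(prednK n0) big_nat_recl //= /gf_term /= eqxx expr0 mulr1 lerDl.
by rewrite sumr_ge0 // => i _; rewrite mulr_ge0 ?exprn_ge0 // (srw_prob_ge0 i.+1).
Unshelve. all: by end_near.
Qed.

(** [mean] does not increase the supremum norm, so n uses of the equation bound |h| by z^n K. *)
Lemma bounded_resolvent0 (h : T -> R) z K : 0 <= z -> z < 1 ->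
  (forall x, vset X x -> `|h x| <= K) ->
  (forall x, vset X x -> h x = z * mean h x) ->
  forall x, vset X x -> h x = 0.
Proof.
move=> z0 z1 hK hE x Xx; have K0 : 0 <= K by apply: le_trans (hK x Xx).
have P n y : vset X y -> `|h y| <= z ^+ n * K.
  elim: n y => [|n IH] y Xy; first by rewrite mul1r hK.
  rewrite hE // normrM ger0_norm // exprS -mulrA ler_wpM2l //.
  apply: mean_le => [|w yw]; first by rewrite mulr_ge0 ?exprn_ge0.
  by apply: IH; apply: (@edge_vset _ X w y); rewrite edge_sym.
have c0 : (fun n => z ^+ n * K) @ \oo --> 0.
  have -> : (fun n => z ^+ n * K) = geometric K z.
    by apply/funext => n; rewrite /geometric /= mulrC.
  by apply: cvg_geometric; rewrite ger0_norm.
apply/eqP; rewrite -normr_le0.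
rewrite -(cvg_lim _ c0) //; apply: limr_ge; first by apply/cvg_ex; exists 0.
by near=> n; exact: P.
Unshelve. all: by end_near.
Qed.

Lemma gf_even z : bipartite X -> gf o (- z) = gf o z.
Proof.
case=> color colP; rewrite /gf; congr (limn (series _)); apply/funext => n; rewrite /gf_term.
have odd0 m x : (odd m != (color x != color o)) -> srw_prob R X m x o = 0.
  elim: m x => [|m IH] x.
    move=> h /=; rewrite (_ : (x == o) = false) //; apply: contraNF h => /eqP ->.
    by rewrite eqxx.
  rewrite srw_probS /mean => h; rewrite big_seq big1 ?mulr0 // => w.
  rewrite mem_nbr_seq => /colP xw; apply: IH; move: h xw => /=.
  by case: (odd m); case: (color x); case: (color w); case: (color o).
case: (boolP (odd n)) => on; first by rewrite odd0 ?mul0r // on eqxx.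
by rewrite exprNn -signr_odd (negPf on) mul1r.
Qed.

End GreenReal.

(** * The complex Green function at real points *)

Section GreenComplex.
Import Order.TTheory GRing.Theory Num.Theory numFieldNormedType.Exports.
Local Open Scope complex_scope.
Local Open Scope ring_scope.

Lemma green_real (R : realType) (T : choiceType) (X : graph T) (o : T) (z : R) :
  locally_finite X -> `|z| < 1 -> @green R T X o z%:C = (gf X o o z)%:C.
Proof.
move=> lf z1; rewrite /green.
apply: (@power_series_rmorph R _ (real_complex R)) => [x y|x|e e0|].
- exact: ltcR.
- by rewrite normc_def /= expr0n addr0 sqrtr_sqr.
(* A positive element of the complex field is real, so its real part can serve as e'. *)
- move: e0; rewrite ltcE /= => /andP[/eqP ie re]; exists (complex.Re e) => //.
  by rewrite -[X in _ <= X]RRe_real //; case: e ie re => a b /= -> _; rewrite complex_real.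
- exact: gf_cvg.
Qed.

End GreenComplex.

(** * Cells of a self-similar graph *)

Section GraphFacts.
Local Open Scope classical_set_scope.
Set Implicit Arguments.
Unset Strict Implicit.
Unset Printing Implicit Defensive.

Lemma uniq_map_inj (T U : eqType) (f : T -> U) (s : seq T) :
  uniq (map f s) -> {in s &, injective f}.
Proof.
move=> u x y xs ys fxy.
have ix : index x s < size (map f s) by rewrite size_map index_mem.
have iy : index y s < size (map f s) by rewrite size_map index_mem.
have := nth_uniq (f x) ix iy u.
rewrite !(nth_map x) ?index_mem // !nth_index // fxy eqxx => /esym/eqP e.
by rewrite -(nth_index x xs) e nth_index.
Qed.

Variable T : choiceType.
Implicit Types (G : graph T).

Lemma joined_trans G x y z : joined G x y -> joined G y z -> joined G x z.
Proof.
move=> [p pp <-] [q qp <-]; exists (p ++ q); last by rewrite last_cat.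
by rewrite cat_path pp.
Qed.

Lemma joined_edge G x y : edge G x y -> joined G x y.
Proof. by move=> e; exists [:: y] => //=; rewrite e. Qed.

Lemma joined_sym G x y : joined G x y -> joined G y x.
Proof.
case=> p; elim: p x => [|z p IH] x /=; first by move=> _ ->; exists nil.
case/andP => xz zp E; apply: joined_trans (IH z zp E) _.
by apply: joined_edge; rewrite edge_sym.
Qed.

Lemma joined_closed G (S : T -> Prop) x y :
  (forall u v, S u -> edge G u v -> S v) -> joined G x y -> S x -> S y.
Proof.
move=> H [p]; elim: p x => [|z p IH] x /=; first by move=> _ <-.
by case/andP => xz zp E Sx; apply: IH zp E _; apply: H xz.
Qed.

Lemma graph_iso_comp (G H K : graph T) f g :
  graph_iso G H f -> graph_iso H K g -> graph_iso G K (g \o f).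
Proof.
move=> [[fs fi fj] ef] [[gs gi gj] eg]; split; last first.
  by move=> x y Gx Gy /=; rewrite eg ?ef //; apply: fs.
split=> [x Gx|x y /set_mem Gx /set_mem Gy /= e|z /gj[y /fj[x Gx <-] <-]].
- exact/gs/fs.
- by apply: fi; rewrite ?inE //; apply: gi; rewrite ?inE //; apply: fs.
- by exists x.
Qed.

Lemma graph_iso_inj (G H : graph T) f x y :
  graph_iso G H f -> vset G x -> vset G y -> f x = f y -> x = y.
Proof. by move=> [[_ fi _] _] Gx Gy; apply: fi; rewrite inE. Qed.

Lemma graph_iso_mem (G H : graph T) f x : graph_iso G H f -> vset G x -> vset H (f x).
Proof. by move=> [[fs _ _] _] Gx; apply: fs. Qed.

Lemma graph_iso_surj (G H : graph T) f y :
  graph_iso G H f -> vset H y -> exists2 x, vset G x & f x = y.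
Proof. by move=> [[_ _ fs] _] /fs[x Gx <-]; exists x. Qed.

End GraphFacts.

Section Cells.
Local Open Scope classical_set_scope.
Set Implicit Arguments.
Unset Strict Implicit.
Unset Printing Implicit Defensive.

Variables (T : choiceType) (X : graph T) (B : set T) (psi : T -> T) (o : T).
Hypotheses (sss : symmetrically_self_similar X B psi) (Ho : origin_vertex X psi o)
  (Hb : branching_number X B 2).

Lemma locfin : locally_finite X. Proof. by case: sss. Qed.
Lemma X_conn x y : vset X x -> vset X y -> joined X x y.
Proof. by case: sss => -[[[_ h] _] _ _ _ _] _ _ _ _; apply: h. Qed.
Lemma B_vset x : B x -> vset X x.
Proof. by case: sss => -[_ h _ _ _] _ _ _ _; apply: h. Qed.
Lemma B_indep x y : B x -> B y -> edge X x y = false.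
Proof. by case: sss => -[_ _ h _ _] _ _ _ _ Bx By; apply/negbTE/h. Qed.
Lemma cells_meet C D x y : cell X B C -> cell X B D -> C <> D ->
  boundary X C x -> boundary X D x -> boundary X C y -> boundary X D y -> x = y.
Proof. by case: sss => -[_ _ _ h _] _ _ _ _ cC cD ne ? ? ? ?; apply: (h C D). Qed.
Lemma psi_iso : graph_iso X (quot_graph X B) psi.
Proof. by case: sss => -[]. Qed.
Lemma cell_finite C : cell X B C -> finite_set C.
Proof. by case: sss => _ _ h _ _; apply: h. Qed.

Lemma edge_vsetr x y : edge X x y -> vset X y.
Proof. by rewrite edge_sym; apply: edge_vset. Qed.

Lemma exists_nbr x : vset X x -> exists y, edge X x y.
Proof.
move=> Xx; have infX : infinite_set (vset X) by case: sss => -[[]].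
have [y Xy xy] : exists2 y, vset X y & x <> y.
  apply: contrapT => h; apply: infX; apply: (@sub_finite_set _ _ [set x]); last exact: finite_set1.
  move=> y Xy /=; apply: contrapT => ne; apply: h; exists y => // e; exact: ne.
have [[|z p] /=] := X_conn Xx Xy; first by move=> _ /xy.
by case/andP => xz _ _; exists z.
Qed.

Lemma in_cell y : vset X y -> ~ B y -> exists2 C, cell X B C & C y.
Proof.
move=> Xy nBy; exists [set z | joined (Defs.induced X (~` B)) y z]; last by exists nil.
by exists y => //; split.
Qed.

Lemma cell_mem C y : cell X B C -> C y -> vset X y /\ ~ B y.
Proof.
move=> [x [Xx nBx] ->] /=.
move=> h; apply: (joined_closed (S := fun y => vset X y /\ ~ B y) _ h) => // u v _.
by case/and3P => _ /set_mem nBv /edge_vsetr Xv.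
Qed.

Lemma cell_step C y w : cell X B C -> C y -> edge X y w -> ~ B w -> C w.
Proof.
move=> cC Cy yw nBw; have [Xy nBy] := cell_mem cC Cy.
case: cC Cy => x _ -> /= xy; apply: joined_trans xy _; apply: joined_edge.
by apply/and3P; split => //; apply/mem_set.
Qed.

Lemma cell_uniq C D y : cell X B C -> cell X B D -> C y -> D y -> C = D.
Proof.
move=> [x _ ->] [x' _ ->] /= xy x'y; apply/seteqP; split => z /= h.
  by apply: joined_trans x'y _; apply: joined_trans (joined_sym xy) h.
by apply: joined_trans xy _; apply: joined_trans (joined_sym x'y) h.
Qed.

Lemma cell_joined C y z : cell X B C -> C y -> C z -> joined (Defs.induced X (~` B)) y z.
Proof. by move=> [x _ ->] /= xy xz; apply: joined_trans (joined_sym xy) xz. Qed.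

Lemma boundary_B C y : cell X B C -> boundary X C y -> B y.
Proof.
move=> cC [Xy [nCy [x Cx xy]]]; apply: contrapT => nBy.
by apply: nCy; apply: cell_step Cx xy nBy.
Qed.

Lemma boundary_edge C y v : cell X B C -> C y -> B v -> edge X v y -> boundary X C v.
Proof.
move=> cC Cy Bv vy; split; first exact: edge_vset vy.
split; last by exists y => //; rewrite edge_sym.
by move=> Cv; have [] := cell_mem cC Cv.
Qed.

Lemma boundary_two C : cell X B C ->
  exists a b, [/\ a <> b, boundary X C a, boundary X C b &
    forall x, boundary X C x -> x = a \/ x = b].
Proof.
move=> cC; have /card_set_bijP[f [fs fi fj]] := Hb cC.
have [a ba fa] : (f @` boundary X C) 0 by apply: fj.
have [b bb fb] : (f @` boundary X C) 1 by apply: fj.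
exists a, b; split => // [e|x bx]; first by move: fa fb; rewrite e => ->.
have := fs x bx; case E : (f x) => [|[|n]] //= _; [left|right].
  by apply: fi; rewrite ?inE // E fa.
by apply: fi; rewrite ?inE // E fb.
Qed.

Lemma boundary_other C v : cell X B C -> boundary X C v ->
  exists w, [/\ boundary X C w, v <> w & forall x, boundary X C x -> x = v \/ x = w].
Proof.
move=> cC; have [a [b [ab ba bb H]]] := boundary_two cC.
case/H => ->; first by exists b.
exists a; split => // [e|x /H[]]; [exact: ab|by right|by left].
Qed.

Definition across v y w := exists C,
  [/\ cell X B C, C y, boundary X C v, boundary X C w & v <> w].

Lemma across_exists v y : B v -> edge X v y -> exists w, across v y w.
Proof.
move=> Bv vy; have nBy : ~ B y by move=> By; move: vy; rewrite B_indep.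
have [C cC Cy] := in_cell (edge_vsetr vy) nBy.
have bv := boundary_edge cC Cy Bv vy.
by have [w [bw vw _]] := boundary_other cC bv; exists w, C.
Qed.

Lemma across_fun v y w w' : across v y w -> across v y w' -> w = w'.
Proof.
move=> [C [cC Cy bv bw vw]] [D [cD Dy dv dw vw']].
have E := cell_uniq cC cD Cy Dy; subst D.
have [w0 [_ _ H]] := boundary_other cC bv.
by case: (H _ bw) => [e|->]; [case: vw|case: (H _ dw) => [e|//]; case: vw'].
Qed.

(** The default v is never taken when v lies in B and y is a neighbour of v. *)
Definition opposite v y := xget v [set w | across v y w].

Lemma oppositeP v y : B v -> edge X v y -> across v y (opposite v y).
Proof. by move=> Bv vy; apply: (@xgetPex _ v [set w | across v y w]); exact: across_exists. Qed.

Lemma opposite_eq v y w : B v -> edge X v y -> across v y w -> opposite v y = w.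
Proof. by move=> Bv vy h; apply: across_fun h; exact: oppositeP. Qed.

Lemma quot_edgeP v w : quot_edge X B v w <-> exists2 y, edge X v y & across v y w.
Proof.
split.
  case/and4P => /eqP vw _ _ /asboolP[C [cC bv bw]].
  by case: (bv) => _ [_ [y Cy yv]]; exists y; [rewrite edge_sym|exists C].
move=> [y vy [C [cC Cy bv bw vw]]]; apply/and4P; split.
- exact/eqP.
- by apply/mem_set/(boundary_B cC).
- by apply/mem_set/(boundary_B cC).
- by apply/asboolP; exists C.
Qed.

Lemma psi_vset x : vset X x -> B (psi x).
Proof. exact: (graph_iso_mem psi_iso). Qed.

Lemma o_vset : vset X o. Proof. by case: Ho. Qed.
Lemma psi_o : psi o = o. Proof. by case: Ho. Qed.
Lemma o_B : B o. Proof. by rewrite -psi_o; exact/psi_vset/o_vset. Qed.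

Lemma psi_inj x y : vset X x -> vset X y -> psi x = psi y -> x = y.
Proof. exact: graph_iso_inj psi_iso. Qed.

Lemma quot_edge_psi x w : vset X x ->
  quot_edge X B (psi x) w <-> exists2 y, edge X x y & psi y = w.
Proof.
move=> Xx; split.
  move=> h; have Bw : B w by move: h; case/and4P => _ _ /set_mem.
  have [y Xy E] := graph_iso_surj psi_iso (Bw : vset (quot_graph X B) w).
  exists y => //; have [_ <-] := psi_iso => //; by rewrite E.
move=> [y xy <-]; have Xy := edge_vsetr xy.
by have [_ h] := psi_iso; have := h x y Xx Xy; rewrite xy.
Qed.

Lemma psi_nbr_uniq x : vset X x -> uniq (map psi (nbr_seq X x)).
Proof.
move=> Xx; rewrite map_inj_in_uniq; first exact: nbr_seq_uniq.
move=> y z; rewrite !(mem_nbr_seq locfin) => xy xz; by apply: psi_inj; [exact: edge_vsetr xy|exact: edge_vsetr xz].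
Qed.

(** The two lists agree as sets because [psi] identifies X with X_B; their agreement as multisets
    has to wait for [opposite_inj]. *)
Lemma opposite_mem x w : vset X x ->
  (w \in map (opposite (psi x)) (nbr_seq X (psi x))) = (w \in map psi (nbr_seq X x)).
Proof.
move=> Xx; have Bv := psi_vset Xx; apply/mapP/mapP => -[y].
  rewrite (mem_nbr_seq locfin) => vy ->.
  have : quot_edge X B (psi x) (opposite (psi x) y).
    by apply/quot_edgeP; exists y => //; exact: oppositeP.
  by case/(quot_edge_psi _ Xx) => z xz <-; exists z => //; rewrite (mem_nbr_seq locfin).
rewrite (mem_nbr_seq locfin) => xy ->.
have /quot_edgeP[z vz h] : quot_edge X B (psi x) (psi y) by apply/(quot_edge_psi _ Xx); exists y.
by exists z; [rewrite (mem_nbr_seq locfin)|rewrite (opposite_eq Bv vz h)].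
Qed.

(* At the origin [psi] preserves the degree, so no two neighbours share a cell. *)
Lemma origin_nbr_inj : {in nbr_seq X o &, injective (opposite o)}.
Proof.
apply: uniq_map_inj; have Xo := o_vset.
apply: (@leq_size_uniq _ (map psi (nbr_seq X o))).
- exact: psi_nbr_uniq.
- by move=> w; rewrite -opposite_mem // psi_o.
- by rewrite !size_map.
Qed.

Lemma closed_cell_vset C x : cell X B C ->
  vset (closed_cell X C) x <-> C x \/ boundary X C x.
Proof.
move=> cC; split; first by case.
move=> h; split => //; case: h => [Cx|[]//]; by have [] := cell_mem cC Cx.
Qed.

Lemma closed_cell_edge C x y : cell X B C ->
  vset (closed_cell X C) x -> vset (closed_cell X C) y ->
  edge (closed_cell X C) x y = edge X x y.
Proof.
move=> cC [_ Cx] [_ Cy]; rewrite /closed_cell /= /induced_edge.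
by rewrite !mem_set.
Qed.

(** Double transitivity corrects an arbitrary isomorphism of closed cells so that the boundary
    vertices go where they are wanted. *)
Lemma closed_cell_iso C D a b a' b' : cell X B C -> cell X B D ->
  boundary X C a -> boundary X C b -> a <> b ->
  boundary X D a' -> boundary X D b' -> a' <> b' ->
  exists f, [/\ graph_iso (closed_cell X C) (closed_cell X D) f,
    f @` boundary X C = boundary X D, f a = a' & f b = b'].
Proof.
move=> cC cD ba bb ab ba' bb' ab'; case: sss => _ _ _ iso dt.
have [f [If fb]] := iso C D cC cD.
have fa : boundary X D (f a) by rewrite -fb; exists a.
have fbb : boundary X D (f b) by rewrite -fb; exists b.
have ne : f a <> f b.
  by move/(graph_iso_inj If) => e; apply/ab/e; apply/(closed_cell_vset _ cC); right.
have [g [Ig gb ga gbb]] := dt D cD _ _ _ _ fa fbb ba' bb' ne ab'.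
exists (g \o f); split => //; first exact: graph_iso_comp If Ig.
by rewrite -image_comp fb gb.
Qed.

Lemma iso_cell C D f x : cell X B C -> cell X B D ->
  graph_iso (closed_cell X C) (closed_cell X D) f ->
  f @` boundary X C = boundary X D -> C x -> D (f x).
Proof.
move=> cC cD If fb Cx.
have Vx : vset (closed_cell X C) x by apply/(closed_cell_vset _ cC); left.
have /(closed_cell_vset _ cD)[//|] := graph_iso_mem If Vx.
rewrite -fb => -[y by' E]; have : y = x.
  by apply: (graph_iso_inj If) => //; apply/(closed_cell_vset _ cC); right.
by move=> yx; subst y; case: by' => _ [].
Qed.

(** An isomorphism carries the cell to one at the origin with v sent to o. The images of y and y'
    then lie in one cell, so they have the same opposite vertex, and [origin_nbr_inj] identifies
    them. *)
Lemma cell_nbr_uniq C v y y' : cell X B C -> boundary X C v ->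
  C y -> C y' -> edge X v y -> edge X v y' -> y = y'.
Proof.
move=> cC bv Cy Cy' vy vy'; have [w [bw vw _]] := boundary_other cC bv.
have [z oz] := exists_nbr o_vset.
have [w' [D [cD Dz bo bw' ow']]] := across_exists o_B oz.
have [f [If fb fv fw]] := closed_cell_iso cC cD bv bw vw bo bw' ow'.
have Vv : vset (closed_cell X C) v by apply/(closed_cell_vset _ cC); right.
have V u : C u -> vset (closed_cell X C) u by move=> h; apply/(closed_cell_vset _ cC); left.
have E u : C u -> edge X v u -> edge X o (f u).
  move=> Cu; rewrite -(closed_cell_edge cC Vv (V u Cu)).
  case: (If) => _ <- //; last exact: V.
  by rewrite fv closed_cell_edge //; [rewrite -fv|]; apply: (graph_iso_mem If) => //; apply: V.
have A u : C u -> edge X v u -> across o (f u) w'.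
  by move=> Cu vu; exists D; split => //; apply: iso_cell If fb Cu.
apply: (graph_iso_inj If); [exact: V|exact: V|].
apply: origin_nbr_inj; rewrite ?(mem_nbr_seq locfin) ?E //.
by rewrite (opposite_eq o_B (E y Cy vy) (A y Cy vy)) (opposite_eq o_B (E y' Cy' vy') (A y' Cy' vy')).
Qed.

(** Two different cells at v with the same opposite vertex would meet in two points; within one cell
    [cell_nbr_uniq] applies. *)
Lemma opposite_inj v : B v -> {in nbr_seq X v &, injective (opposite v)}.
Proof.
move=> Bv y y'; rewrite !(mem_nbr_seq locfin) => vy vy' E.
have [C [cC Cy bv bw vw]] := oppositeP Bv vy.
have [D [cD Dy bv' bw' _]] := oppositeP Bv vy'.
rewrite -E in bw'; have CD : C = D.
  by apply: contrapT => ne; apply: vw; apply: (cells_meet cC cD ne).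
by subst D; exact: (cell_nbr_uniq cC bv Cy Dy vy vy').
Qed.

(** This turns sums over the neighbours of psi x, taken through opposite vertices, into sums over
    the neighbours of x. *)
Lemma perm_opposite x : vset X x ->
  perm_eq (map (opposite (psi x)) (nbr_seq X (psi x))) (map psi (nbr_seq X x)).
Proof.
move=> Xx; apply: uniq_perm; last by move=> w; exact: opposite_mem.
  by rewrite map_inj_in_uniq ?nbr_seq_uniq //; exact/opposite_inj/psi_vset.
exact: psi_nbr_uniq.
Qed.

Lemma degree_psi x : vset X x -> degree X (psi x) = degree X x.
Proof.
by move=> Xx; have := perm_size (perm_opposite Xx); rewrite !size_map.
Qed.

End Cells.

(** * The functional equation *)

Section CellNetwork.
Import Order.TTheory GRing.Theory Num.Theory.
Local Open Scope classical_set_scope.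
Local Open Scope ring_scope.
Set Implicit Arguments.
Unset Strict Implicit.
Unset Printing Implicit Defensive.

Variables (R : realType) (T : choiceType) (X : graph T) (B : set T) (psi : T -> T) (o : T).
Hypotheses (sss : symmetrically_self_similar X B psi) (Ho : origin_vertex X psi o)
  (Hb : branching_number X B 2).
Variables (C : set T) (a b c c' : T).
Hypotheses (cC : cell X B C) (bda : boundary X C a) (bdb : boundary X C b) (ab : a <> b)
  (bd2 : forall x, boundary X C x -> x = a \/ x = b)
  (Cc : C c) (ac : edge X a c) (Cc' : C c') (bc' : edge X b c').

Let lf := locfin sss.

(** The order puts b at [ord0] and a at [lift ord0 ord0], as the two terminals of the network. *)
Definition cell_enum : seq T := b :: a :: fset_set C.
Local Notation t := cell_enum.
Local Notation N := (size (fset_set C)).+1.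
Local Notation l := (lift ord0).
Definition cvert (i : 'I_N.+1) : T := nth b t i.
Definition cindex (x : T) : 'I_N.+1 := inord (index x t).
Definition cadj (i j : 'I_N.+1) : bool := edge X (cvert i) (cvert j).

Lemma mem_fsetC x : (x \in (fset_set C : seq T)) <-> C x.
Proof. by rewrite in_fset_set; [split=> [/set_mem|/mem_set]|exact: (cell_finite sss cC)]. Qed.

Lemma cell_enum_uniq : uniq t.
Proof.
rewrite /= fset_uniq inE !negb_or andbT; apply/andP; split; last first.
  by apply/negP => /mem_fsetC; case: bda => _ [].
apply/andP; split; first by apply/eqP => e; exact: ab.
by apply/negP => /mem_fsetC; case: bdb => _ [].
Qed.

Lemma mem_cell_enum x : x \in t <-> vset (closed_cell X C) x.
Proof.
rewrite (closed_cell_vset _ cC) !inE; split.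
  by case/or3P => [/eqP ->|/eqP ->|/mem_fsetC]; [right|right|left].
case=> [/mem_fsetC ->|/bd2[] ->]; by rewrite ?eqxx ?orbT.
Qed.

Lemma cvert_mem i : cvert i \in t.
Proof. exact: mem_nth. Qed.

Lemma cvert_vset i : vset (closed_cell X C) (cvert i).
Proof. exact/mem_cell_enum/cvert_mem. Qed.

Lemma cvertK i : cindex (cvert i) = i.
Proof.
apply: val_inj; rewrite /= inordK ?index_mem ?cvert_mem // index_uniq ?cell_enum_uniq //.
Qed.

Lemma cindexK x : vset (closed_cell X C) x -> cvert (cindex x) = x.
Proof.
move=> /mem_cell_enum xt; rewrite /cvert /cindex inordK ?nth_index //.
by have := index_mem x t; rewrite xt => ->.
Qed.

Lemma cvert_inj : injective cvert.
Proof. exact: can_inj cvertK. Qed.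

Lemma cvert0 : cvert ord0 = b. Proof. by []. Qed.
Lemma cvert_a : cvert (l ord0) = a. Proof. by []. Qed.

Lemma cvert_l i : i != ord0 -> C (cvert (l i)).
Proof.
move=> i0; have /(closed_cell_vset _ cC)[//|/bd2[]] := cvert_vset (l i).
  by rewrite -cvert_a => /cvert_inj /lift_inj e; rewrite e eqxx in i0.
by rewrite -cvert0 => /cvert_inj /eqP; rewrite eq_sym (negPf (neq_lift _ _)).
Qed.

Lemma cvert_surj x : C x -> exists2 i, cvert (l i) = x & i != ord0.
Proof.
move=> Cx; have Vx : vset (closed_cell X C) x by apply/(closed_cell_vset _ cC); left.
have := cindexK Vx; case: (unliftP ord0 (cindex x)) => [k ->|->] E.
  exists k => //; apply/eqP => k0; rewrite k0 cvert_a in E; subst x.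
  by case: bda => _ [].
by rewrite cvert0 in E; subst x; case: bdb => _ [].
Qed.

Lemma cvert_l_cases i : C (cvert (l i)) \/ i = ord0.
Proof. by have [->|/cvert_l] := eqVneq i ord0; [right|left]. Qed.

Lemma a_B : B a. Proof. exact: boundary_B cC bda. Qed.
Lemma b_B : B b. Proof. exact: boundary_B cC bdb. Qed.

Lemma cadj_sym : symmetric cadj. Proof. by move=> i j; rewrite /cadj edge_sym. Qed.

Variables (ic jc : 'I_N).
Hypotheses (Hic : cvert (l ic) = c) (Hjc : cvert (l jc) = c').

Lemma cadj_a y : cadj (l ord0) y = (y == l ic).
Proof.
apply/idP/eqP => [|->]; last by rewrite /cadj Hic.
rewrite /cadj cvert_a => ay; apply: cvert_inj; rewrite Hic.
have /(closed_cell_vset _ cC)[Cy|/(boundary_B cC) By] := cvert_vset y.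
  exact: (cell_nbr_uniq sss Ho Hb cC bda Cy Cc ay ac).
by move: ay; rewrite (B_indep sss a_B By).
Qed.

Lemma cadj_b y : cadj ord0 y = (y == l jc).
Proof.
apply/idP/eqP => [|->]; last by rewrite /cadj Hjc.
rewrite /cadj cvert0 => ay; apply: cvert_inj; rewrite Hjc.
have /(closed_cell_vset _ cC)[Cy|/(boundary_B cC) By] := cvert_vset y.
  exact: (cell_nbr_uniq sss Ho Hb cC bdb Cy Cc' ay bc').
by move: ay; rewrite (B_indep sss b_B By).
Qed.

(** C is connected and a is attached to it through c, so the closed cell stays connected when b is
    removed. *)
Lemma cadj_conn (S : pred 'I_N) i : S i ->
  (forall j k, S j -> cadj (l j) (l k) -> S k) -> forall k, S k.
Proof.
move=> Si H; pose PS x := exists2 k, cvert (l k) = x & S k.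
have [x Cx Px] : exists2 x, C x & PS x.
  have [Ci|i0] := cvert_l_cases i; first by exists (cvert (l i)) => //; exists i.
  exists c => //; exists ic => //; apply: (H i) => //.
  by rewrite i0 cadj_a.
have all_C z : C z -> PS z.
  move=> Cz; have J := cell_joined cC Cx Cz.
  suff [] : C z /\ PS z by [].
  apply: (joined_closed (S := fun y => C y /\ PS y) _ J) => // u v [Cu [k Ek Sk]].
  case/and3P => _ /set_mem nBv uv; have Cv := cell_step cC Cu uv nBv.
  split => //; have [k' Ek' _] := cvert_surj Cv; exists k' => //.
  by apply: (H k) => //; rewrite /cadj Ek Ek'.
have C_all k : C (cvert (l k)) -> S k.
  by move=> /all_C[k' /cvert_inj /lift_inj <-].
move=> k; have [/C_all //|->] := cvert_l_cases k.
apply: (H ic); first by apply: C_all; rewrite Hic.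
by rewrite cadj_sym cadj_a.
Qed.

Lemma cell_swap : exists s : 'I_N.+1 -> 'I_N.+1,
  [/\ injective s, forall x y, cadj (s x) (s y) = cadj x y, s ord0 = l ord0 & s (l ord0) = ord0].
Proof.
have [g [Ig _ ga gb]] := closed_cell_iso sss cC cC bda bdb ab bdb bda (fun e => ab (esym e)).
have Vg i := graph_iso_mem Ig (cvert_vset i).
pose s i := cindex (g (cvert i)).
have sE i : cvert (s i) = g (cvert i).
  by rewrite /s cindexK.
exists s; split.
- move=> i j /(congr1 cvert); rewrite !sE => e; apply: cvert_inj.
  by apply: (graph_iso_inj Ig) => //; exact: cvert_vset.
- move=> i j; rewrite /cadj !sE.
  rewrite -(closed_cell_edge cC (Vg i) (Vg j)).
  case: Ig => _ ->; try exact: cvert_vset.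
  by rewrite (closed_cell_edge cC) //; exact: cvert_vset.
- by apply: cvert_inj; rewrite sE cvert0 gb.
- by apply: cvert_inj; rewrite sE cvert_a ga.
Qed.

Local Notation pa := (npa R cadj).
Local Notation pD := (npD R cadj ord0).
Local Notation pb := (npb R cadj ord0 jc).

Section Transport.
Variables (D : set T) (phi : T -> T).
Hypotheses (cD : cell X B D) (Iphi : graph_iso (closed_cell X C) (closed_cell X D) phi)
  (phib : phi @` boundary X C = boundary X D).

(** All neighbours of an interior vertex lie in the closed cell, so averages over neighbours in X
    can be computed in the network. *)
Lemma transport_nbr i : C (cvert i) ->
  perm_eq (nbr_seq X (phi (cvert i))) [seq phi (cvert j) | j <- enum 'I_N.+1 & cadj i j].
Proof.
move=> Ci; have Di := iso_cell cC cD Iphi phib Ci.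
have Vphi j := graph_iso_mem Iphi (cvert_vset j).
have edgeE j : edge X (phi (cvert i)) (phi (cvert j)) = cadj i j.
  rewrite -(closed_cell_edge cD (Vphi i) (Vphi j)).
  case: Iphi => _ ->; try exact: cvert_vset.
  by rewrite (closed_cell_edge cC) //; exact: cvert_vset.
apply: (perm_nbr_seq lf).
  rewrite map_inj_in_uniq; first by apply: filter_uniq; exact: enum_uniq.
  move=> j k _ _ e.
  by apply: cvert_inj; apply: (graph_iso_inj Iphi) => //; exact: cvert_vset.
move=> w; apply/mapP/idP => [[j]|iw].
  by rewrite mem_filter => /andP[ij _] ->; rewrite edgeE.
have Vw : vset (closed_cell X D) w.
  apply/(closed_cell_vset _ cD); have [Bw|nBw] := pselect (B w).
    by right; apply: (boundary_edge cD Di Bw); rewrite edge_sym.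
  by left; apply: (cell_step cD Di iw nBw).
have [x Vx E] := graph_iso_surj Iphi Vw.
exists (cindex x); last by rewrite cindexK.
by rewrite mem_filter mem_enum andbT -edgeE cindexK // E.
Qed.

Lemma transport_sum (F : T -> R) i : C (cvert i) ->
  \sum_(w <- nbr_seq X (phi (cvert i))) F w = \sum_j (cadj i j)%:R * F (phi (cvert j)).
Proof.
move=> Ci; rewrite (perm_big _ (transport_nbr Ci)) /= big_map big_filter big_enum_cond /=.
rewrite big_mkcond /=; apply: eq_bigr => j _.
by case: (cadj i j); rewrite ?mul1r ?mul0r.
Qed.

Lemma transport_degree i : C (cvert i) -> (degree X (phi (cvert i)))%:R = ndeg R cadj i.
Proof.
move=> Ci; have := transport_sum (fun=> 1) Ci.
rewrite big_const_seq count_predT iter_addr_0 size_nbr_seq => ->.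
by apply: eq_bigr => j _; rewrite mulr1.
Qed.

(** The Green function pulled back along [phi] solves the resolvent equation without source inside
    the cell, because o lies in B; so [nGreen] applies to it. *)
Lemma cell_relation v y w z : 0 < z -> z < 1 -> D y -> boundary X D v ->
  edge X v y -> phi a = v -> phi b = w ->
  pD.[z] * (gf X o v z - z * gf X o y z : R) = pa.[z] * gf X o v z - pb.[z] * gf X o w z.
Proof.
move=> z0 z1 Dy bv vy fa fb; pose u i := gf X o (phi (cvert i)) z : R.
have zn : `|z| < 1 by rewrite ger0_norm // ltW.
have fc : phi (cvert (l ic)) = y.
  have Dc : D (phi c) := iso_cell cC cD Iphi phib Cc.
  rewrite Hic; apply: (cell_nbr_uniq sss Ho Hb cD bv) => //.
  have V x : C x \/ boundary X C x -> vset (closed_cell X C) x by move/(closed_cell_vset _ cC).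
  have Va := V a (or_intror bda); have Vc := V c (or_introl Cc).
  rewrite -fa -(closed_cell_edge cD (graph_iso_mem Iphi Va) (graph_iso_mem Iphi Vc)).
  by case: Iphi => _ -> //; rewrite (closed_cell_edge cC).
have -> : gf X o v z = u (l ord0) by rewrite /u cvert_a fa.
have -> : gf X o w z = u ord0 by rewrite /u cvert0 fb.
have -> : gf X o y z = u (l ic) by rewrite /u fc.
apply: (nGreen cadj_sym cadj_a cadj_b).
  move=> i i0; have Ci := cvert_l i0.
  have := gf_resolvent lf o (phi (cvert (l i))) zn.
  have -> : (phi (cvert (l i)) == o) = false.
    apply/eqP => e; have [_] := cell_mem cD (iso_cell cC cD Iphi phib Ci).
    by apply; rewrite e; exact: (o_B sss Ho).
  rewrite add0r /mean transport_sum // transport_degree //.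
  have D0 := nD_gt0 R cadj_sym cadj_a cadj_b cadj_conn i.
  rewrite -/(nD R cadj i) -/(u (l i)) => E.
  have {E} : nD R cadj i * u (l i) = z * \sum_j (cadj (l i) j)%:R * u j.
    by rewrite E mulrCA mulVKf ?gt_eqF.
  rewrite /pencil big_ord_recl cadj_sym cadj_b (inj_eq lift_inj) => ->.
  by rewrite mulrDr addrK mulrA.
Qed.

End Transport.

Lemma opposite_relation v y z : 0 < z -> z < 1 -> B v -> edge X v y ->
  pD.[z] * (gf X o v z - z * gf X o y z : R) =
  pa.[z] * gf X o v z - pb.[z] * gf X o (opposite X B v y) z.
Proof.
move=> z0 z1 Bv vy; have [D [cD Dy bv bw vw]] := oppositeP sss Hb Bv vy.
have [phi [Iphi phib fa fb]] := closed_cell_iso sss cC cD bda bdb ab bv bw vw.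
exact: (cell_relation cD Iphi phib z0 z1 Dy bv vy fa fb).
Qed.

Lemma degree_gt0 x : vset X x -> 0 < (degree X x)%:R :> R.
Proof.
move=> Xx; have [y xy] := exists_nbr sss Xx; rewrite ltr0n -size_nbr_seq.
by have : y \in nbr_seq X x; [rewrite (mem_nbr_seq lf)|case: (nbr_seq X x)].
Qed.

(** Summed over the neighbours of psi x, [opposite_relation] has on its left a multiple of the
    source at o, and on its right the resolvent operator at d applied to x -> gf (psi x) z. So h
    solves the homogeneous equation at d; being bounded it vanishes, and its vanishing at the fixed
    point o is the claim. *)
Lemma green_functional z : 0 < z -> z < 1 ->
  pa.[z] * gf X o o z = pD.[z] * gf X o o (pb.[z] / pa.[z]) :> R.
Proof.
move=> z0 z1; set d := pb.[z] / pa.[z].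
have [d0 d1] : 0 <= d /\ d < 1 := ndistance_bound cadj_sym cadj_a cadj_b cadj_conn z0 z1.
have pa0 : pa.[z] != 0.
  have [y [y1 py _]] := nsup R cadj_sym cadj_a cadj_b cadj_conn.
  by rewrite gt_eqF // (npa_gt0 cadj_sym cadj_a cadj_b cadj_conn py) ?(ltW z0) ?(lt_trans z1).
have zn : `|z| < 1 by rewrite ger0_norm // ltW.
have dn : `|d| < 1 by rewrite ger0_norm.
pose h x := pa.[z] * gf X o (psi x) z - pD.[z] * gf X o x d : R.
suff : h o = 0 by rewrite /h (psi_o Ho) => /eqP; rewrite subr_eq0 => /eqP.
apply: (@bounded_resolvent0 R T X lf h d
  (`|pa.[z]| * (1 - z)^-1 + `|pD.[z]| * (1 - d)^-1) d0 d1).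
- move=> x _; apply: le_trans (ler_normB _ _) _; rewrite !normrM lerD // ler_wpM2l //.
    by apply: gf_bound => //; exact: ltW.
  exact: gf_bound.
- move=> x Xx; have Bv := psi_vset sss Xx; have Xv := B_vset sss Bv.
  have dg := degree_gt0 Xx; have dv := degree_psi sss Ho Hb Xx.
  have S1 : \sum_(y <- nbr_seq X (psi x)) pD.[z] * (gf X o (psi x) z - z * gf X o y z) =
     \sum_(y <- nbr_seq X (psi x)) (pa.[z] * gf X o (psi x) z -
        pb.[z] * gf X o (opposite X B (psi x) y) z) :> R.
    rewrite !big_seq; apply: eq_bigr => y; rewrite (mem_nbr_seq lf) => vy.
    exact: opposite_relation.
  have cst (k : R) : \sum_(y <- nbr_seq X (psi x)) k = (degree X x)%:R * k.
    by rewrite big_const_seq count_predT iter_addr_0 size_nbr_seq dv mulr_natl.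
  rewrite sumrB -!mulr_sumr sumrB -!mulr_sumr !cst in S1.
  have opp : \sum_(y <- nbr_seq X (psi x)) gf X o (opposite X B (psi x) y) z =
      \sum_(y <- nbr_seq X x) gf X o (psi y) z :> R.
    rewrite -(big_map (opposite X B (psi x)) xpredT (fun w => gf X o w z)).
    by rewrite (perm_big _ (perm_opposite sss Ho Hb Xx)) big_map.
  rewrite opp in S1.
  have E1 := gf_resolvent lf o (psi x) zn; have E2 := gf_resolvent lf o x dn.
  have po : (psi x == o) = (x == o).
    apply/eqP/eqP => [e|->]; last exact: (psi_o Ho).
    apply: (psi_inj sss Xx (o_vset Ho)); by rewrite e (psi_o Ho).
  rewrite po in E1.
  have hm : mean X h x = pa.[z] * mean X (fun y => gf X o (psi y) z) x -
      pD.[z] * mean X (fun y => gf X o y d) x.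
    by rewrite /mean /h sumrB -!mulr_sumr; ring.
  rewrite hm; move: S1 E1 E2; rewrite /h /mean dv.
  set u := gf X o (psi x) z; set S := \sum_(y <- nbr_seq X (psi x)) gf X o y z.
  set g := gf X o x d; set V := \sum_(y <- nbr_seq X x) gf X o (psi y) z.
  set W := \sum_(y <- nbr_seq X x) gf X o y d; set dl := (x == o)%:R.
  set n := (degree X x)%:R in dg *; move=> S1 E1 E2.
  have n0 : n != 0 by rewrite gt_eqF.
  have E1' : n * u - z * S = n * dl.
    by rewrite E1; field.
  have S1' : pD.[z] * (n * dl) = n * (pa.[z] * u) - pb.[z] * V.
    by rewrite -E1' S1; ring.
  have -> : pa.[z] * u = pD.[z] * dl + pb.[z] * (n^-1 * V).
    apply: (mulfI n0); rewrite -[LHS](subrK (pb.[z] * V)) -S1'; field.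
    exact: n0.
  rewrite {1}E2 /d; field; by rewrite n0 pa0.
- exact: (o_vset Ho).
Qed.

End CellNetwork.

Section ClosedCell.
Import Order.TTheory GRing.Theory Num.Theory.
Local Open Scope ring_scope.

Lemma closed_cell_path (R : realType) (T : choiceType) (X : graph T) (B : set T)
    (psi : T -> T) (o : T) (C : set T) :
  symmetrically_self_similar X B psi -> origin_vertex X psi o -> branching_number X B 2 ->
  bipartite X -> algebraic_on (@unit_disc R) (@green R T X o) -> cell X B C ->
  exists (n : nat) (f : T -> nat), graph_iso (closed_cell X C) (path_graph n) f.
Proof.
move=> sss Ho Hb bip [P P0 Palg] cC.
have lf := locfin sss.
have [a [b [ab bda bdb bd2]]] := boundary_two Hb cC.
have [_ [_ [c Cc ca]]] := bda; have [_ [_ [c' Cc' cb]]] := bdb.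
have ac : edge X a c by rewrite edge_sym.
have bc' : edge X b c' by rewrite edge_sym.
have [ic Hic _] := cvert_surj sss cC bda bdb bd2 Cc.
have [jc Hjc _] := cvert_surj sss cC bda bdb bd2 Cc'.
have Gpos (z : R) : 0 <= z -> z < 1 -> gf X o o z != 0.
  by move=> z0 z1; rewrite gt_eqF // (lt_le_trans ltr01) // gf_ge1.
have G0 (z : R) : -1 < z -> z < 1 -> gf X o o z != 0.
  move=> z1 z2; case: (lerP 0 z) => [z0|z0]; first exact: Gpos.
  by rewrite -gf_even // Gpos ?oppr_ge0 ?(ltW z0) // ltrNl.
have Pann : annihilates (gf X o o) P.
  move=> z z1 z2; have zn : `|z| < 1 by rewrite ltr_norml z1.
  rewrite -(green_real o lf zn); apply: Palg.
  by rewrite /unit_disc /= normc_def /= expr0n addr0 sqrtr_sqr -[1]/(1%:C%C) ltcR.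
have [s [s_inj s_adj s_b s_a]] := cell_swap sss cC bda bdb ab bd2.
have [color colP] := bip.
have [t [ut t_all tadj]] := network_path (cadj_sym X a b)
  (cadj_a sss Ho Hb cC bda bdb ab bd2 Cc ac Hic)
  (cadj_b sss Ho Hb cC bda bdb ab bd2 Cc' bc' Hjc)
  (cadj_conn sss Ho Hb cC bda bdb ab bd2 Cc ac Hic)
  (fun x y => colP _ _) s_inj s_adj s_b s_a P0 Pann G0 (fun z => gf_even lf o z bip)
  (fun z z0 z1 => green_functional sss Ho Hb cC bda bdb ab bd2 Cc ac Cc' bc' Hic Hjc z0 z1).
pose ix := cindex C a b.
have ixK x : vset (closed_cell X C) x -> cvert a b (ix x) = x.
  exact: (cindexK sss cC bda bdb bd2).
have ix_t x : (index (ix x) t < size t)%N by rewrite index_mem t_all.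
exists (size t), (fun x => index (ix x) t); split.
  split=> [x _|x y /set_mem Vx /set_mem Vy e|n /= nt].
  - exact: ix_t.
  - rewrite -(ixK x Vx) -(ixK y Vy); congr (cvert a b _).
    by rewrite -(nth_index ord0 (t_all (ix x))) e nth_index.
  - exists (cvert a b (nth ord0 t n)); first exact: (cvert_vset sss cC bda bdb bd2).
    by rewrite /ix (cvertK sss cC bda bdb ab) index_uniq.
move=> x y Vx Vy; rewrite (closed_cell_edge cC Vx Vy) /= /path_edge !ix_t /=.
by rewrite -tadj /cadj !ixK.
Qed.

End ClosedCell.

Theorem theorem4p7 (R : realType) (T : choiceType) (X : graph T) (B : set T)
    (psi : T -> T) (o : T) :
  symmetrically_self_similar X B psi ->
  bounded_geometry X ->
  origin_vertex X psi o ->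
  branching_number X B 2 ->
  bipartite X ->
  algebraic_on (@unit_disc R) (@green R T X o) ->
  forall C : set T, cell X B C ->
    exists (n : nat) (f : T -> nat),
      graph_iso (closed_cell X C) (path_graph n) f.
Proof.
by move=> sss _ Ho Hb bip alg C; apply: closed_cell_path sss Ho Hb bip alg.
Qed.
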